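(* Let $\kappa\in\{-1,1\}$ and $\mathcal{H}\in C^1([-1,1])$, and suppose that there exists a closed $\mathcal{H}$-surface $\mathcal{K}_{\mathcal{H}}$ in $\mathbb{M}^2(\kappa)\times\mathbb{R}$. Then: 1. If $\mathcal{K}_{\mathcal{H}}\subset\mathbb{H}^2\times\mathbb{R}$ (case $\kappa=-1$), then $\mathcal{H}(-1)\mathcal{H}(1)>0$. 2. If $\mathcal{K}_{\mathcal{H}}\subset\mathbb{S}^2\times\mathbb{R}$ (case $\kappa=1$), one of the following holds: - $\mathcal{H}(-1)\mathcal{H}(1)>0$; - $\mathcal{H}(-1)\mathcal{H}(1)=0$, and $\mathcal{K}_{\mathcal{H}}$ is a horizontal plane $\mathbb{S}^2\times\{t_0\}$ for some $t_0\in\mathbb{R}$.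
   Context: $\mathbb{M}^2(\kappa)$ is the complete simply connected surface of constant curvature $\kappa$: the hyperbolic plane $\mathbb{H}^2$ if $\kappa=-1$ and the unit sphere $\mathbb{S}^2$ if $\kappa=1$. $\mathbb{M}^2(\kappa)\times\mathbb{R}$ carries the product metric, and $\partial_z$ is the unit vertical Killing field, the gradient of the height function (projection onto $\mathbb{R}$). Given $\mathcal{H}\in C^1([-1,1])$, an immersed oriented surface $\Sigma$ in $\mathbb{M}^2(\kappa)\times\mathbb{R}$ with unit normal $\eta$ is an $\mathcal{H}$-surface if its mean curvature $H_\Sigma$ with respect to $\eta$ (half the sum of the principal curvatures) satisfies $H_\Sigma(p)=\mathcal{H}(\nu(p))$ for all $p\in\Sigma$, where $\nu(p)=\langle\eta_p,\partial_z\rangle$ is the angle function. Sign convention: a vertical graph $z=u$ oriented by its upward unit normal has $2H_\Sigma=\mathrm{div}(\nabla u/\sqrt{1+|\nabla u|^2})$, divergence and gradient being taken in $\mathbb{M}^2(\kappa)$. Closed means compact without boundary; surfaces are immersed (self-intersections allowed), connected, and not necessarily rotational. Standing assumption: the (possible) zeros of $\mathcal{H}$ are isolated and of finite multiplicity. *)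

(* Defs.v *)
From HB Require Import structures.
From mathcomp Require Import all_boot all_order all_algebra.
From mathcomp Require Import all_classical all_reals all_analysis.
Set Implicit Arguments.
Unset Strict Implicit.
Unset Printing Implicit Defensive.
Import Order.TTheory GRing.Theory Num.Theory.
Import numFieldNormedType.Exports.
Local Open Scope classical_set_scope.
Local Open Scope ring_scope.

Section PrescribedFunction.
Variable R : realType.
Implicit Types (f : R -> R) (s : R).

(* Differentiability relative to [-1, 1], hence one-sided at the endpoints;
   the values of [f] outside [-1, 1] play no role. *)
Definition C1_on_segment f : Prop :=
  exists df : R -> R,
    {within `[-1, 1], continuous df} /\
    forall s, -1 <= s <= 1 ->
      (f y - f s) / (y - s) @[y --> within `[-1, 1] s^'] --> df s.

Definition isolated_zero f s : Prop :=
  \forall y \near within `[-1, 1] s^', f y != 0.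

(* [f] does not vanish to infinite order at [s].  If [f] is smooth this says
   that some derivative of [f] at [s] is nonzero.  In general it is implied by
   any factorization [f y = (y - s) ^+ m * g y] near [s] with [g] continuous
   and [g s != 0]. *)
Definition finite_multiplicity f s : Prop :=
  exists m : nat, ~ (f y / (y - s) ^+ m @[y --> within `[-1, 1] s^'] --> 0).

Definition zeros_isolated_of_finite_multiplicity f : Prop :=
  forall s, -1 <= s <= 1 -> f s = 0 ->
    isolated_zero f s /\ finite_multiplicity f s.

End PrescribedFunction.

Section DifferentiableMaps.
Variables (R : realType) (n : nat) (W : normedModType R).
Implicit Type f : 'rV[R]_n.+1 -> W.

Definition pderive (i : 'I_n.+1) f (u : 'rV[R]_n.+1) : W :=
  'D_(delta_mx 0 i) f u.

(* To be used on open sets [U]. *)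
Fixpoint Ck_on (k : nat) (U : set 'rV[R]_n.+1) f : Prop :=
  (forall u, U u -> {for u, continuous f}) /\
  match k with
  | 0%N => True
  | k'.+1 => forall i,
      (forall u, U u -> derivable f u (delta_mx 0 i)) /\
      Ck_on k' U (pderive i f)
  end.

(* The columns of the Jacobian at [u] are linearly independent, i.e. the
   differential is injective. *)
Definition immersive_at f (u : 'rV[R]_n.+1) : Prop :=
  forall a : 'rV[R]_n.+1, \sum_i a 0 i *: pderive i f u = 0 -> a = 0.

End DifferentiableMaps.

Section AbstractSurfaces.
Variables (R : realType) (T : topologicalType).

(* Inverse charts: homeomorphisms from an open subset of the plane onto an
   open subset of [T].  The values of [lp_map] outside [lp_dom], and of
   [lp_inv] outside the image of [lp_dom], are junk. *)
Record local_param := LocalParam {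
  lp_dom : set 'rV[R]_2;
  lp_map :> 'rV[R]_2 -> T;
  lp_inv : T -> 'rV[R]_2;
  lp_open_dom : open lp_dom;
  lp_open_image : open (lp_map @` lp_dom);
  lp_mapK : forall u, lp_dom u -> lp_inv (lp_map u) = u;
  lp_map_continuous : forall u, lp_dom u -> {for u, continuous lp_map};
  lp_inv_continuous :
    forall p, (lp_map @` lp_dom) p -> {for p, continuous lp_inv} }.

Implicit Type A : set local_param.

Definition C2_compatible (x y : local_param) : Prop :=
  Ck_on 2 (lp_dom x `&` x @^-1` (y @` lp_dom y)) (lp_inv y \o x).

Definition C2_atlas A : Prop :=
  (forall p, exists2 x, A x & (x @` lp_dom x) p) /\
  (forall x y, A x -> A y -> C2_compatible x y).

(* There is no boundary because charts are modelled on open subsets of the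
   plane; second countability follows from compactness. *)
Definition closed_connected_surface A : Prop :=
  [/\ [set: T] !=set0, hausdorff_space T, compact [set: T],
      connected [set: T] & C2_atlas A].

End AbstractSurfaces.

Section ProductSpace.
Variables (R : realType) (kappa : R).

(* Everything below is meant for [kappa = 1] and [kappa = -1]. *)

(* Euclidean product of R^3 if kappa = 1, Lorentzian if kappa = -1. *)
Definition form3 (v w : 'rV[R]_3) : R :=
  v 0 (inord 0) * w 0 (inord 0) + v 0 (inord 1) * w 0 (inord 1)
  + kappa * (v 0 (inord 2) * w 0 (inord 2)).

(* The unit sphere if kappa = 1; the upper sheet of the hyperboloid
   <q, q> = -1 in Minkowski space if kappa = -1. *)
Definition M2 : set 'rV[R]_3 :=
  [set q | form3 q q = kappa /\ (kappa < 0 -> 0 < q 0 (inord 2))].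

Definition M2xR : set ('rV[R]_3 * R) := [set P | M2 P.1].

Definition slice (t0 : R) : set ('rV[R]_3 * R) :=
  [set P | M2 P.1 /\ P.2 = t0].

(* Restricted to vectors tangent to [M2xR], this is the product metric. *)
Definition metric (V W : 'rV[R]_3 * R) : R := form3 V.1 W.1 + V.2 * W.2.

Definition tangent (P V : 'rV[R]_3 * R) : Prop := form3 P.1 V.1 = 0.

Definition dz : 'rV[R]_3 * R := (0, 1).

Implicit Types (X : 'rV[R]_2 -> 'rV[R]_3 * R) (N : 'rV[R]_3 * R)
  (u : 'rV[R]_2).

Definition unit_normal X u N : Prop :=
  [/\ tangent (X u) N, metric N N = 1 &
      forall i, metric (pderive i X u) N = 0].

Definition first_form X u : 'M[R]_2 :=
  \matrix_(i, j) metric (pderive i X u) (pderive j X u).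

(* II(X_i, X_j) = <nabla_{X_i} X_j, N>.  The flat second derivative may be used
   for the Levi-Civita one of [M2xR]: their difference is orthogonal to
   [M2xR], hence to [N]. *)
Definition second_form X N u : 'M[R]_2 :=
  \matrix_(i, j) metric (pderive i (pderive j X) u) N.

(* Its eigenvalues are the principal curvatures with respect to [N]. *)
Definition shape_operator X N u : 'M[R]_2 :=
  invmx (first_form X u) *m second_form X N u.

(* With this sign, a graph z = f with upward normal has
   2 H = div (grad f / sqrt (1 + |grad f|^2)). *)
Definition mean_curvature X N u : R := \tr (shape_operator X N u) / 2.

End ProductSpace.

Section HSurfaces.
Variables (R : realType) (kappa : R) (T : topologicalType).
Variable A : set (local_param R T).
Implicit Types psi eta : T -> 'rV[R]_3 * R.

Definition C2_immersion psi : Prop :=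
  (forall p, M2xR kappa (psi p)) /\
  forall x, A x -> Ck_on 2 (lp_dom x) (psi \o x) /\
    forall u, lp_dom x u -> immersive_at (psi \o x) u.

(* As [M2xR] is oriented, orienting the surface amounts to a continuous choice
   of unit normal. *)
Definition unit_normal_field psi eta : Prop :=
  continuous eta /\
  forall x, A x -> forall u, lp_dom x u ->
    unit_normal kappa (psi \o x) u (eta (x u)).

Definition angle eta (p : T) : R := metric kappa (eta p) (dz R).

Definition H_surface (H : R -> R) psi eta : Prop :=
  [/\ C2_immersion psi, unit_normal_field psi eta &
      forall x, A x -> forall u, lp_dom x u ->
        mean_curvature kappa (psi \o x) (eta (x u)) u = H (angle eta (x u))].

End HSurfaces.

(* Main.v *)
Require Import Defs.
From HB Require Import structures.
From mathcomp Require Import all_boot all_order all_algebra.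
From mathcomp Require Import all_classical all_reals all_analysis.
From mathcomp Require Import ring lra.
Set Implicit Arguments.
Unset Strict Implicit.
Unset Printing Implicit Defensive.
Import Order.TTheory GRing.Theory Num.Theory.
Import numFieldNormedType.Exports.
Local Open Scope classical_set_scope.
Local Open Scope ring_scope.

(** A closed surface has a highest and a lowest point, and everything follows from
    comparing it there with the horizontal slices.

    The height h of an H-surface satisfies Laplacian h = 2 H(nu) nu and
    |grad h|^2 = 1 - nu^2 ([height_equation], [gradient_angle]; both come from the
    decomposition of the vertical field in [dz_decomposition]).  At an extremum
    nu is 1 or -1, and the sign of the Laplacian gives nu H(nu) <= 0 at a highest
    point and nu H(nu) >= 0 at a lowest one ([extremum_sign]).  If neither number
    vanishes, nu takes opposite signs at the two points, so H(1) and H(-1) have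
    the same strict sign and the product is positive.

    If H vanishes at the angle eps of one of these extrema, then
    H(nu) = O(1 - nu^2) = O(|grad h|^2) near it: the slice solves the same
    equation, and Hopf's strong maximum principle ([strong_maximum_principle]),
    applied in charts to the height itself, shows that h is constant near the
    point.  A connectedness argument makes h constant on the whole surface
    ([height_constant]), which is therefore immersed in a slice
    ([horizontal_or_positive]).

    In the hyperbolic case no closed surface is immersed in a slice: the third
    coordinate of the hyperboloid model has no critical point outside the vertex,
    where it is minimal ([not_hyperbolic]).

    In the spherical case the projection to the sphere is a local homeomorphism
    ([chart_locally_injective], [chart_locally_open]) from a compact connected
    space to a simply connected one, hence a homeomorphism ([sphere_covering]).
    The latter is proved by lifting all meridians from a point above the north
    pole; the lifts end at one and the same point above the south pole, because
    the fibres are discrete and the circle of longitudes is connected, so they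
    define a continuous section of the projection, whose image is open and
    closed.  Thus the immersion is injective and fills the slice. *)

(** * One-variable calculus along lines *)

Section Lines.
Variables (R : realType) (V W : normedModType R).

Lemma is_derive_line (f : V -> W) (u v : V) (t : R) (d : W) :
  is_derive (u + t *: v) v f d -> is_derive t 1 (fun s => f (u + s *: v)) d.
Proof.
have E : (fun h : R => h^-1 *: (((fun s => f (u + s *: v)) \o shift t) (h *: (1 : R))
    - f (u + t *: v))) =
  (fun h => h^-1 *: ((f \o shift (u + t *: v)) (h *: v) - f (u + t *: v))).
  apply/funext => h /=; congr (_ *: (f _ - _)).
  by rewrite -[h *: 1]/(h * 1) mulr1 scalerDl addrCA addrA.
by move=> [df <-]; split; [rewrite /derivable E|rewrite /derive E].
Qed.

End Lines.

Section MeanValue.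
Variables (R : realType) (V W : normedModType R).

Lemma mean_value_line (f g : V -> R) (u v : V) :
  (forall t : R, 0 <= t <= 1 -> is_derive (u + t *: v) v f (g (u + t *: v))) ->
  exists2 t : R, 0 <= t <= 1 & f (u + v) - f u = g (u + t *: v).
Proof.
move=> df.
have dl (t : R) : t \in `[0, 1]%R ->
    is_derive t 1 (fun s => f (u + s *: v)) (g (u + t *: v)).
  by rewrite in_itv => /df D; exact: is_derive_line.
have dlo (t : R) : t \in `]0, 1[%R ->
    is_derive t 1 (fun s : R => f (u + s *: v)) (g (u + t *: v)).
  by move=> /subset_itv_oo_cc ti; exact: dl.
have cl : {within `[0, 1], continuous (fun s : R => f (u + s *: v))}.
  by apply: derivable_within_continuous => x xi; case: (dl x xi).
have [t t01 E] := MVT_segment ler01 dlo cl.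
by exists t; [move: t01; rewrite in_itv|move: E; rewrite subr0 mulr1 scale1r scale0r addr0].
Qed.

Definition functional (L : W -> R) :=
  (forall k v w, L (k *: v + w) = k * L v + L w) /\ continuous L.

(** Applied to the coordinates of the ambient space and to the products with
    fixed vectors, this turns the vector-valued derivatives of a
    parametrization into derivatives of scalar functions, for which the maximum
    principle and the mean value theorem are available. *)
Lemma is_derive_functional (L : W -> R) (f : V -> W) (u v : V) (d : W) :
  functional L -> is_derive u v f d -> is_derive u v (L \o f) (L d).
Proof.
move=> [linL cL] [df dE].
have L0 : L 0 = 0 by have := linL 1 0 0; rewrite scaler0 addr0 mul1r; lra.
have LZ k w : L (k *: w) = k * L w by rewrite -[k *: w]addr0 linL L0 addr0.
have E : (fun h : R => h^-1 *: (((L \o f) \o shift u) (h *: v) - (L \o f) u)) =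
  L \o (fun h => h^-1 *: ((f \o shift u) (h *: v) - f u)).
  apply/funext => h /=; rewrite LZ -[_ *: _]/(_ * _); congr (_ * _).
  by rewrite -[in RHS](scaleN1r (f u)) [in RHS]addrC linL mulN1r addrC.
have cv : (L \o (fun h => h^-1 *: ((f \o shift u) (h *: v) - f u))) @ 0^' --> L d.
  apply: continuous_cvg; first exact: cL.
  by rewrite -dE; exact: df.
by split; [rewrite /derivable E; apply/cvg_ex; exists (L d)
          |rewrite /derive E; apply/cvg_lim].
Qed.

End MeanValue.

Section SecondDerivativeTest.
Variable R : realType.

(** If [c] were positive, [f1] would be positive just to the right of [0], and
    the mean value theorem would make [f] exceed [f 0] there. *)
Lemma second_derivative_test (f f1 : R -> R) (c : R) :
  (\forall t \near (0 : R), is_derive (t : R) (1 : R) f (f1 t)) -> is_derive (0 : R) (1 : R) f1 c ->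
  (\forall t \near (0 : R), f t <= f 0) -> f1 0 = 0 /\ c <= 0.
Proof.
move=> df df1 fmax.
have [r /= r0 Hr] := filterI df fmax.
have {}Hr (t : R) : `|t| < r -> is_derive t 1 f (f1 t) /\ f t <= f 0.
  by move=> tr; apply: Hr; rewrite /= sub0r normrN.
have f10 : f1 0 = 0.
  have i0 : 0 \in `](-r), r[%R by rewrite in_itv /= oppr_lt0 r0.
  have itvr t : t \in `](-r), r[%R -> `|t| < r by rewrite in_itv /= ltr_norml.
  have D : is_derive (0 : R) (1 : R) f 0.
    apply: (@derive1_at_max _ f (- r) r 0) => //.
    - by rewrite ge0_cp // ltW.
    - by move=> t /itvr /Hr [].
    - by move=> t /itvr /Hr [].
  have [[_ <-] _] := Hr 0 (itvr _ i0).
  by case: D.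
split=> //; rewrite leNgt; apply/negP => c0.
case: df1 => df1 dE.
have : h^-1 *: ((f1 \o shift 0) (h *: (1 : R)) - f1 0) @[h --> 0^'] --> c.
  by rewrite -dE; exact: df1.
move=> /cvgr_gt /(_ _ c0) [r' /= r'0 Hr'].
pose t := Num.min r r' / 2.
have t0 : 0 < t by rewrite divr_gt0 // lt_min r0.
have tm : t < Num.min r r' by rewrite /t ltr_pdivrMr // ltr_pMr ?ltr1n // lt_min r0.
have tr : t < r by apply: lt_le_trans tm _; rewrite ge_min lexx.
have tr' : t < r' by apply: lt_le_trans tm _; rewrite ge_min lexx orbT.
have pos s : 0 < s <= t -> 0 < f1 s.
  move=> /andP[s0 st].
  have := Hr' s; rewrite /= sub0r normrN gtr0_norm // (le_lt_trans st) //.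
  move=> /(_ isT (lt0r_neq0 s0)).
  by rewrite addr0 f10 subr0 -[s *: 1]/(s * 1) mulr1 -[_ *: _]/(_ * _) pmulr_rgt0 // invr_gt0.
have dft (s : R) : s \in `[0, t]%R -> is_derive s 1 f (f1 s).
  rewrite in_itv /= => /andP[s0 st]; apply: (Hr s _).1.
  by rewrite ger0_norm // (le_lt_trans st).
have dfo (s : R) : s \in `]0, t[%R -> is_derive s 1 f (f1 s).
  by move=> /subset_itv_oo_cc si; exact: dft.
have cf : {within `[0, t], continuous f}.
  by apply: derivable_within_continuous => s si; case: (dft s si).
have [s st] := MVT t0 dfo cf.
rewrite subr0 => E.
have /Hr[_] : `|t| < r by rewrite gtr0_norm.
rewrite -subr_le0 E.
rewrite leNgt => /negP; apply; apply: mulr_gt0 => //; apply: pos.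
by move: st; rewrite in_itv /= => /andP[-> /ltW].
Qed.

End SecondDerivativeTest.

(** * Functions of two variables with continuous partial derivatives *)

Section PlaneCalculus.
Variable R : realType.
Local Notation plane := 'rV[R]_2.

Lemma ord2_1 : lift ord0 ord0 = 1 :> 'I_2.
Proof. exact: val_inj. Qed.

Lemma plane_decomp (a : plane) : a = a 0 0 *: delta_mx 0 0 + a 0 1 *: delta_mx 0 1.
Proof.
rewrite {1}[a]row_sum_delta big_ord_recl big_ord_recl big_ord0 addr0.
by rewrite ord2_1.
Qed.

(** The derivatives are passed as explicit functions, so that compositions of a
    parametrization with a linear form carry their partial derivatives along
    without any rewriting under [pderive]. *)
Definition partials (U : set plane) (f : plane -> R) (g : 'I_2 -> plane -> R) :=
  forall u, U u -> forall i,
    is_derive u (delta_mx 0 i) f (g i u) /\ {for u, continuous (g i)}.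

Lemma is_derive_scale_dir (V W : normedModType R) (f : V -> W) (u v : V) (k : R) d :
  is_derive u v f d -> is_derive u (k *: v) f (k *: d).
Proof.
have [->|k0] := eqVneq k 0; first by rewrite !scale0r => _; exact: is_derive0.
move=> [df dE].
have E : (fun h : R => h^-1 *: ((f \o shift u) (h *: (k *: v)) - f u)) =
   (fun h => k *: (((fun h => h^-1 *: ((f \o shift u) (h *: v) - f u)) \o ( *%R k)) h)).
  apply/funext => h /=; rewrite scalerA [h * k]mulrC.
  by rewrite scalerA invfM mulrA divff // mul1r.
have cv : (fun h => k *: (((fun h => h^-1 *: ((f \o shift u) (h *: v) - f u)) \o ( *%R k)) h)) @ 0^'
    --> k *: d.
  apply: cvgZr; rewrite -dE.
  apply: cvg_comp df => A [e /= e0 He].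
  exists (e / `|k|) => /=; first by rewrite divr_gt0 // normr_gt0.
  move=> h /=; rewrite !sub0r !normrN ltr_pdivlMr ?normr_gt0 // => hk h0.
  by apply: He; rewrite /= ?sub0r ?normrN ?normrM 1?mulrC // mulf_neq0.
by split; [rewrite /derivable E; apply/cvg_ex; exists (k *: d)
          |rewrite /derive E; apply/cvg_lim].
Qed.

(** Continuous partial derivatives give all directional derivatives: the
    increment along [a] is split into two increments parallel to the axes, each
    controlled by the mean value theorem. *)
Lemma directional_derivative (U : set plane) f g u (a : plane) :
  open U -> partials U f g -> U u ->
  is_derive u a f (a 0 0 * g 0 u + a 0 1 * g 1 u).
Proof.
move=> oU dfg Uu.
set d := _ + _.
suff cv : (fun h : R => h^-1 *: ((f \o shift u) (h *: a) - f u)) @ 0^' --> d.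
  by split; [apply/cvg_ex; exists d|apply/cvg_lim].
pose e i : plane := delta_mx 0 i.
pose M : R := `|a 0 0| + `|a 0 1| + 1.
have M0 : 0 < M by rewrite ltr_wpDl // addr_ge0.
pose N : R := `|e 0| + `|e 1| + 1.
have N0 : 0 < N by rewrite ltr_wpDl // addr_ge0.
apply/cvgrPdist_le => /= eps eps0.
have eM0 : 0 < eps / M by rewrite divr_gt0.
have close : \forall w \near u, U w /\ forall i, `|g i u - g i w| <= eps / M.
  apply: filterI; first exact: open_nbhs_nbhs.
  have /cvgrPdist_le /(_ _ eM0) c0 := (dfg u Uu 0).2.
  have /cvgrPdist_le /(_ _ eM0) c1 := (dfg u Uu 1).2.
  apply: filterS (filterI c0 c1) => w [w0 w1] i.
  have /orP[/eqP->|/eqP->] // : (i == 0) || (i == 1) by case: i => [[|[]]].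
move: close => /nbhs_ballP [r /= r0 Hr].
have inU s t : (`|s| + `|t|) * N < r -> U (u + s *: e 0 + t *: e 1)
    /\ forall i, `|g i u - g i (u + s *: e 0 + t *: e 1)| <= eps / M.
  move=> st; apply: Hr; rewrite -ball_normE /=.
  rewrite -addrA opprD addrA subrr add0r normrN.
  apply: le_lt_trans st; apply: le_trans (ler_normD _ _) _; rewrite !normrZ.
  have : 0 <= `|s| by []. have : 0 <= `|t| by []. have : 0 <= `|e 0| by [].
  have : 0 <= `|e 1| by [].
  by rewrite /N; nra.
rewrite near_withinE; near=> h => h0.
have hr : `|h| * (M * N) < r.
  near: h; exists (r / (M * N)) => /=; first by rewrite divr_gt0 // mulr_gt0.
  by move=> h /=; rewrite sub0r normrN ltr_pdivlMr // mulr_gt0.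
pose s := h * a 0 0; pose t := h * a 0 1.
have st : (`|s| + `|t|) * N < r.
  apply: le_lt_trans hr; rewrite mulrA ler_pM2r // !normrM -mulrDr ler_pM2l ?normr_gt0 //.
  by rewrite /M lerDl.
have scl (k x : R) : 0 <= k <= 1 -> `|k * x| <= `|x|.
  by move=> /andP[k0 k1]; rewrite normrM ger0_norm // ler_piMl.
have [k k01 E1] : exists2 k : R, 0 <= k <= 1 &
    f (u + s *: e 0 + t *: e 1) - f (u + s *: e 0) =
    t * g 1 (u + s *: e 0 + k *: (t *: e 1)).
  apply: (@mean_value_line _ _ f (fun w => t * g 1 w)) => k k01.
  rewrite scalerA; apply: is_derive_scale_dir; apply: (dfg _ _ 1).1.
  apply: (inU _ _ _).1; apply: le_lt_trans st.
  by rewrite ler_pM2r // lerD2l scl.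
have [l l01 E0] : exists2 l : R, 0 <= l <= 1 &
    f (u + s *: e 0) - f u = s * g 0 (u + l *: (s *: e 0)).
  apply: (@mean_value_line _ _ f (fun w => s * g 0 w)) => l l01.
  rewrite scalerA; apply: is_derive_scale_dir; apply: (dfg _ _ 0).1.
  rewrite -[_ + _]addr0 -(scale0r (e 1)).
  apply: (inU _ _ _).1; apply: le_lt_trans st.
  by rewrite normr0 addr0 ler_pM2r // (le_trans (scl _ _ l01)) // lerDl.
have B1 : `|g 1 u - g 1 (u + s *: e 0 + k *: (t *: e 1))| <= eps / M.
  rewrite scalerA; apply: (inU _ _ _).2; apply: le_lt_trans st.
  by rewrite ler_pM2r // lerD2l scl.
have B0 : `|g 0 u - g 0 (u + l *: (s *: e 0))| <= eps / M.
  rewrite scalerA -[_ + _ *: _]addr0 -(scale0r (e 1)).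
  apply: (inU _ _ _).2; apply: le_lt_trans st.
  by rewrite normr0 addr0 ler_pM2r // (le_trans (scl _ _ l01)) // lerDl.
have -> : h^-1 *: ((f \o shift u) (h *: a) - f u) =
    a 0 0 * g 0 (u + l *: (s *: e 0)) + a 0 1 * g 1 (u + s *: e 0 + k *: (t *: e 1)).
  have -> : (f \o shift u) (h *: a) - f u =
    s * g 0 (u + l *: (s *: e 0)) + t * g 1 (u + s *: e 0 + k *: (t *: e 1)).
    have Ea : h *: a + u = u + s *: e 0 + t *: e 1.
      by rewrite {1}[a]plane_decomp scalerDr !scalerA addrC addrA.
    by rewrite -E0 -E1 /= Ea; ring.
  by rewrite -[_ *: _]/(_ * _) /s /t -!mulrA -mulrDr mulKf.
rewrite /d opprD addrACA -!mulrBr.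
apply: le_trans (ler_normD _ _) _; rewrite !normrM.
have : `|a 0 0| * `|g 0 u - g 0 (u + l *: (s *: e 0))| <= `|a 0 0| * (eps / M).
  by rewrite ler_wpM2l.
have : `|a 0 1| * `|g 1 u - g 1 (u + s *: e 0 + k *: (t *: e 1))| <= `|a 0 1| * (eps / M).
  by rewrite ler_wpM2l.
have : `|a 0 0| * (eps / M) + `|a 0 1| * (eps / M) + eps / M = eps.
  by rewrite -[X in _ + X]mul1r -!mulrDl -/M mulrC divfK // gt_eqF.
by move: eM0; lra.
Unshelve. all: by end_near. Qed.

End PlaneCalculus.

Section Euclid.
Variable R : realType.
Local Notation plane := 'rV[R]_2.
Implicit Types u v a x : plane.

Definition dot u v : R := u 0 0 * v 0 0 + u 0 1 * v 0 1.
(** The square of the Euclidean norm; the norm of ['rV[R]_2] is the maximum norm,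
    whose balls are not strictly convex, so they cannot serve in the boundary
    point argument. *)
Definition sq u : R := dot u u.

Lemma sq_ge0 u : 0 <= sq u.
Proof. by rewrite /sq /dot; nra. Qed.

Lemma sq_eq0 u : sq u <= 0 -> u = 0.
Proof.
rewrite /sq /dot => h.
have u0 : u 0 0 = 0 by nra.
have u1 : u 0 1 = 0 by nra.
by rewrite [u]plane_decomp u0 u1 !scale0r addr0.
Qed.

Lemma sq_continuous x : continuous (fun u => sq (u - x)).
Proof.
move=> u; rewrite /sq /dot.
have c i : {for u, continuous (fun v : plane => (v - x) 0 i)}.
  rewrite (_ : (fun v : plane => (v - x) 0 i) = (fun v : plane => v 0 i - x 0 i)).
    by apply: continuousB; [exact: coord_continuous|exact: cst_continuous].
  by apply/funext => v; rewrite !mxE.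
have c2 i : {for u, continuous (fun v : plane => (v - x) 0 i * (v - x) 0 i)}.
  by apply: continuousM; exact: c.
exact: continuousD (c2 0) (c2 1).
Qed.

Lemma line_continuous (u a : plane) : continuous (fun t : R => u + t *: a).
Proof. by move=> t; apply: cvgD; [exact: cvg_cst|apply: cvgZl; exact: cvg_id]. Qed.

Lemma near_line (P : plane -> Prop) (u a : plane) :
  (\forall w \near u, P w) -> \forall t \near (0 : R), P (u + t *: a).
Proof.
move=> Pu; have := @line_continuous u a 0; rewrite /continuous_at scale0r addr0.
exact.
Qed.

Lemma sq_lt_ball u x (r : R) : 0 < r -> sq (x - u) < r ^+ 2 -> ball u r x.
Proof.
move=> r0; rewrite /sq /dot => h; split=> // i j; rewrite /ball /= distrC.
have -> : i = 0 by apply/val_inj; case: i => [[]].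
have hj : (x 0 j - u 0 j) ^+ 2 < r ^+ 2.
  have /orP[/eqP->|/eqP->] : (j == 0) || (j == 1) by case: j => [[|[]]].
    by move: h (sqr_ge0 (x 0 1 - u 0 1)); rewrite !mxE !expr2; lra.
  by move: h (sqr_ge0 (x 0 0 - u 0 0)); rewrite !mxE !expr2; lra.
by rewrite -(@ltr_pXn2r _ 2) ?nnegrE ?normr_ge0 ?ltW // real_normK ?num_real.
Qed.

Lemma ball_sq_lt u x (r : R) : ball u r x -> sq (x - u) < 2 * r ^+ 2.
Proof.
move=> [_ b]; rewrite /sq /dot.
have h j : (x 0 j - u 0 j) ^+ 2 < r ^+ 2.
  have := b 0 j; rewrite /ball /= distrC => bj.
  rewrite -[X in X < _]real_normK ?num_real //.
  by rewrite ltr_pXn2r ?nnegrE ?normr_ge0 //; apply: le_trans (ltW bj); rewrite normr_ge0.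
by have := h 0; have := h 1; rewrite !mxE; nra.
Qed.

Lemma disc_compact x (s : R) : compact [set u : plane | sq (u - x) <= s].
Proof.
apply: bounded_closed_compact.
  pose r := 1 + `|s|.
  have r0 : 0 < r by rewrite ltr_pwDl.
  exists (`|x| + r); split; first exact: num_real.
  move=> M rM u /= us; apply: le_trans (ltW rM).
  rewrite -(subrK x u) addrC; apply: le_trans (ler_normD _ _) _; rewrite lerD2l.
  have := @sq_lt_ball x u r r0.
  have s1 : s <= `|s| := ler_norm s.
  have s2 : 0 <= `|s| by [].
  have -> : sq (u - x) < r ^+ 2 by rewrite /r; nra.
  by move=> /(_ isT); rewrite -ball_normE /= distrC => /ltW.
have -> : [set u : plane | sq (u - x) <= s] = (fun u => sq (u - x)) @^-1` [set t | t <= s] by [].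
by apply: closed_comp; [move=> u _; exact: sq_continuous|exact: closed_le].
Qed.

End Euclid.

(** * The strong maximum principle in the plane *)

Section Barrier.
Variable R : realType.
Local Notation plane := 'rV[R]_2.

Lemma is_derive_quadratic (k A B C t : R) :
  is_derive t 1 (fun t => k * (A + B * t + C * t ^+ 2)) (k * (B + 2 * C * t)).
Proof.
have [D E] := @is_derive_poly R (k *: (A%:P + B *: 'X + C *: 'X^2)) t.
rewrite (_ : (fun t => _) = horner (k *: (A%:P + B *: 'X + C *: 'X^2))); last first.
  by apply/funext => s; rewrite !hornerE.
by split; [exact: D|rewrite E !poly.derivE !hornerE; ring].
Qed.

Lemma is_derive_gauss (k A B C t : R) :
  is_derive t 1 (fun t => expR (k * (A + B * t + C * t ^+ 2)))
    (expR (k * (A + B * t + C * t ^+ 2)) * (k * (B + 2 * C * t))).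
Proof. exact: (is_derive1_comp (is_derive_expR _) (is_derive_quadratic _ _ _ _ _)). Qed.

(** First and second order conditions, in every direction [a], at a maximum of
    [f] plus a multiple of the Gaussian centred at [x].  Along a line the
    Gaussian is the exponential of a quadratic polynomial, so everything reduces
    to one variable.  With [eps = 0] this is the usual test at a maximum of
    [f]. *)
Lemma barrier_test (U : set plane) (f : plane -> R) f1 f2 (z x : plane) (eps alpha : R) :
  open U -> U z -> partials U f f1 -> (forall j, partials U (f1 j) (fun i => f2 i j)) ->
  (\forall u \near z, f u + eps * expR (- alpha * sq (u - x)) <=
                      f z + eps * expR (- alpha * sq (z - x))) ->
  let e := eps * expR (- alpha * sq (z - x)) in
  forall a : plane,
  a 0 0 * f1 0 z + a 0 1 * f1 1 z = 2 * alpha * e * dot (z - x) a /\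
  a 0 0 ^+ 2 * f2 0 0 z + a 0 0 * a 0 1 * (f2 0 1 z + f2 1 0 z) + a 0 1 ^+ 2 * f2 1 1 z
   + e * (4 * alpha ^+ 2 * dot (z - x) a ^+ 2 - 2 * alpha * sq a) <= 0.
Proof.
move=> oU Uz pf pf1 zmax e a.
pose A := sq (z - x); pose B := dot (z - x) a; pose C := sq a.
pose q t := A + 2 * B * t + C * t ^+ 2.
have qE t : sq (z + t *: a - x) = q t.
  by rewrite /q /A /B /C /sq /dot !mxE; ring.
pose p t := f (z + t *: a) + eps * expR (- alpha * q t).
pose p0 t := a 0 0 * f1 0 (z + t *: a) + a 0 1 * f1 1 (z + t *: a).
pose g t := expR (- alpha * q t) * (- alpha * (2 * B + 2 * C * t)).
pose p1 t := p0 t + eps * g t.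
have dq t : is_derive t (1 : R) (fun t => eps * expR (- alpha * q t)) (eps * g t).
  by apply: is_deriveZ; exact: is_derive_gauss.
pose c0 := a 0 0 ^+ 2 * f2 0 0 z + a 0 0 * a 0 1 * (f2 0 1 z + f2 1 0 z) + a 0 1 ^+ 2 * f2 1 1 z.
pose cg := expR (- alpha * A) * (4 * alpha ^+ 2 * B ^+ 2 - 2 * alpha * C).
have Dp : \forall t \near (0 : R), is_derive (t : R) (1 : R) p (p1 t).
  near=> t; apply: is_deriveD; last exact: dq.
  have Ut : U (z + t *: a).
    by near: t; apply: near_line; exact: open_nbhs_nbhs.
  by apply: is_derive_line; exact: (directional_derivative a oU pf Ut).
have Dp1 : is_derive (0 : R) (1 : R) p1 (c0 + eps * cg).
  apply: is_deriveD.
    have d0 j : is_derive (0 : R) (1 : R) (fun t : R => f1 j (z + t *: a))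
        (a 0 0 * f2 0 j z + a 0 1 * f2 1 j z).
      apply: is_derive_line; rewrite scale0r addr0.
      exact: (directional_derivative a oU (pf1 j) Uz).
    rewrite (_ : c0 = a 0 0 * (a 0 0 * f2 0 0 z + a 0 1 * f2 1 0 z)
      + a 0 1 * (a 0 0 * f2 0 1 z + a 0 1 * f2 1 1 z)); last by rewrite /c0; ring.
    by apply: is_deriveD; apply: is_deriveZ; exact: d0.
  apply: is_deriveZ.
  have D1 : is_derive (0:R) (1:R) (fun t => - alpha * (2 * B + 2 * C * t)) (- alpha * (2 * C)).
    rewrite (_ : (fun t => _) = (fun t => - alpha * (2 * B + 2 * C * t + 0 * t ^+ 2))).
      by apply: is_derive_eq (is_derive_quadratic _ _ _ _ _) _; ring.
    by apply/funext => s; ring.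
  apply: is_derive_eq (is_deriveM (is_derive_gauss (- alpha) A (2 * B) C 0) D1) _.
  rewrite /cg !mulr0 expr0n !addr0 mulr0 addr0 -![_ *: _]/(_ * _). ring.
have Mp : \forall t \near (0 : R), p t <= p 0.
  have := near_line a zmax; apply: filterS => t.
  by rewrite qE /p -(qE 0) scale0r addr0.
have [p10 p20] := second_derivative_test Dp Dp1 Mp.
split.
  move: p10; rewrite /p1 /p0 /g /q scale0r addr0 !mulr0 expr0n !addr0 mulr0 addr0 /e -/A -/B.
  lra.
by move: p20; rewrite /c0 /cg /e -/A -/B -/C; lra.
Unshelve. all: by end_near. Qed.

End Barrier.

Section InteriorMaximum.
Variable R : realType.
Local Notation plane := 'rV[R]_2.

(** The symmetric matrix of coefficients [G], [- F], [E] is the combination of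
    the squares of the directions [(1, 0)] and [(- F, E)] with the weights
    [(E G - F^2) / E] and [1 / E].  Hence an elliptic operator is controlled by
    two directional second derivatives. *)
Lemma operator_le0_of_directions (E F G p00 p01 p10 p11 : R) : 0 < E -> 0 <= E * G - F ^+ 2 ->
  p00 <= 0 -> F ^+ 2 * p00 - F * E * (p01 + p10) + E ^+ 2 * p11 <= 0 ->
  G * p00 - F * (p01 + p10) + E * p11 <= 0.
Proof.
move=> E0 d0 q0 q1; rewrite -(pmulr_rle0 _ E0).
have -> : E * (G * p00 - F * (p01 + p10) + E * p11) = (E * G - F ^+ 2) * p00 +
  (F ^+ 2 * p00 - F * E * (p01 + p10) + E ^+ 2 * p11) by ring.
by have := mulr_ge0_le0 d0 q0; lra.
Qed.

Lemma interior_max (U : set plane) (f : plane -> R) f1 f2 (z : plane) (E F G : R) :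
  open U -> U z -> partials U f f1 -> (forall j, partials U (f1 j) (fun i => f2 i j)) ->
  0 < E -> 0 < E * G - F ^+ 2 ->
  (\forall u \near z, f u <= f z) ->
  [/\ f1 0 z = 0, f1 1 z = 0 &
      G * f2 0 0 z - F * (f2 0 1 z + f2 1 0 z) + E * f2 1 1 z <= 0].
Proof.
move=> oU Uz pf pf1 E0 d0 zmax.
have zmax' : \forall u \near z, f u + 0 * expR (- 0 * sq (u - z)) <=
                                f z + 0 * expR (- 0 * sq (z - z)).
  by apply: filterS zmax => u; rewrite !mul0r !addr0.
have /= T := barrier_test oU Uz pf pf1 zmax'.
pose vec (a b : R) : plane := a *: delta_mx 0 0 + b *: delta_mx 0 1.
have vec0 a b : vec a b 0 0 = a by rewrite !mxE /= mulr1 mulr0 addr0.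
have vec1 a b : vec a b 0 1 = b by rewrite !mxE /= mulr1 mulr0 add0r.
have [G0 Q0] := T (vec 1 0); have [G1 _] := T (vec 0 1).
have [_ Q1] := T (vec (- F) E).
move: G0 G1 Q0 Q1; rewrite !vec0 !vec1 !(mulr0, mul0r, addr0, add0r, mul1r).
move=> -> -> Q0 Q1; split=> //.
apply: operator_le0_of_directions (ltW d0) _ _ => //; first by move: Q0; rewrite !expr2; lra.
by move: Q1; rewrite !expr2; lra.
Qed.

End InteriorMaximum.

Section StrongMaximumPrinciple.
Variable R : realType.
Local Notation plane := 'rV[R]_2.
Variables (rho lam Lam K : R) (u0 : plane).
Variables (f E F G : plane -> R) (f1 : 'I_2 -> plane -> R)
  (f2 : 'I_2 -> 'I_2 -> plane -> R).
Let U := ball u0 rho.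
Hypotheses (rho0 : 0 < rho) (lam0 : 0 < lam) (K0 : 0 <= K).
Hypothesis f_continuous : forall u, U u -> {for u, continuous f}.
Hypothesis f_partials : partials U f f1.
Hypothesis f1_partials : forall j, partials U (f1 j) (fun i => f2 i j).
Hypothesis E_gt0 : forall u, U u -> 0 < E u.
Hypothesis det_ge : forall u, U u -> lam <= E u * G u - F u ^+ 2.
Hypothesis E_le : forall u, U u -> E u <= Lam.
Hypothesis G_le : forall u, U u -> G u <= Lam.
Hypothesis f_sub : forall u, U u -> - K * (`|f1 0 u| + `|f1 1 u|) <=
  G u * f2 0 0 u - F u * (f2 0 1 u + f2 1 0 u) + E u * f2 1 1 u.
Hypothesis f_max : forall u, U u -> f u <= f u0.

(** The computation behind the Hopf boundary point lemma: if [alpha] is large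
    compared with the ellipticity constants, the operator is so positive on the
    Gaussian, at points whose distance to its centre [x] is comparable to
    [sqrt s], that the differential inequality of [f] forbids a maximum of [f]
    plus a small multiple of the Gaussian. *)
Lemma no_barrier_max (z x : plane) (s eps alpha : R) :
  U z -> 0 < s -> s <= 16 * sq (z - x) -> 8 * sq (z - x) <= 5 * s ->
  0 < eps -> 0 < alpha ->
  alpha * (lam * s) = (2 * Lam + K * (2 + s) + 1) * (16 * Lam) ->
  (\forall u \near z, f u + eps * expR (- alpha * sq (u - x)) <=
                      f z + eps * expR (- alpha * sq (z - x))) -> False.
Proof.
move=> Uz s0 sl su eps0 al0 alE zmax.
have oU : open U by exact: ball_open.
have := barrier_test oU Uz f_partials f1_partials zmax.
set e := eps * _; have e0 : 0 < e by rewrite /e mulr_gt0 // expR_gt0.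
move=> /= T.
pose vec (a b : R) : plane := a *: delta_mx 0 0 + b *: delta_mx 0 1.
have vec0 a b : vec a b 0 0 = a by rewrite !mxE /= mulr1 mulr0 addr0.
have vec1 a b : vec a b 0 1 = b by rewrite !mxE /= mulr1 mulr0 add0r.
have [G0 Q0] := T (vec 1 0); have [G1 _] := T (vec 0 1).
have [_ Q1] := T (vec (- F z) (E z)).
move: G0 G1 Q0 Q1 (f_sub Uz) (E_gt0 Uz) (det_ge Uz) (E_le Uz) (G_le Uz) sl su.
rewrite /sq /dot !vec0 !vec1.
set x0 := (z - x) 0 0; set x1 := (z - x) 0 1.
move: (E z) (F z) (G z) (f1 0 z) (f1 1 z) (f2 0 0 z) (f2 0 1 z) (f2 1 0 z) (f2 1 1 z).
move=> Ez Fz Gz p q p00 p01 p10 p11.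
rewrite !mul1r !mul0r !mulr1 !mulr0 !addr0 !add0r.
move=> Hp Hq Q0 Q1 sub Ez0 dz Ele Gle sl su.
pose Q := Gz * x0 ^+ 2 - 2 * Fz * x0 * x1 + Ez * x1 ^+ 2.
pose L := Gz * p00 - Fz * (p01 + p10) + Ez * p11.
(* the two tests combine into one for the operator *)
have H1 : L + e * (4 * alpha ^+ 2 * Q - 2 * alpha * (Ez + Gz)) <= 0.
  have d0 : 0 <= Ez * Gz - Fz ^+ 2 by apply: le_trans dz; exact: ltW.
  pose c := 4 * alpha ^+ 2 * e; pose d := 2 * alpha * e.
  have -> : L + e * (4 * alpha ^+ 2 * Q - 2 * alpha * (Ez + Gz)) =
    Gz * (p00 + (c * x0 ^+ 2 - d)) - Fz * ((p01 + c * x0 * x1) + (p10 + c * x0 * x1))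
    + Ez * (p11 + (c * x1 ^+ 2 - d)) by rewrite /L /Q /c /d; ring.
  apply: operator_le0_of_directions => //.
    by move: Q0; rewrite /c /d !expr2; lra.
  by move: Q1; rewrite /c /d !expr2; lra.
have P : 0 < 2 * alpha * e by rewrite mulr_gt0 // mulr_gt0.
have Np : `|p| = 2 * alpha * e * `|x0|.
  by rewrite Hp normrM (gtr0_norm P).
have Nq : `|q| = 2 * alpha * e * `|x1|.
  by rewrite Hq normrM (gtr0_norm P).
have H2 : 2 * alpha * Q <= Ez + Gz + K * (`|x0| + `|x1|).
  rewrite -(ler_pM2l P); move: sub; rewrite Np Nq -/L => sub.
  by move: H1 sub; lra.
have Gz0 : 0 < Gz.
  rewrite -(pmulr_rgt0 _ Ez0).
  by move: dz (sqr_ge0 Fz) lam0; lra.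
have N01 : `|x0| + `|x1| <= 2 + s.
  have n0 : `|x0| <= 1 + x0 ^+ 2.
    by rewrite -(real_normK (num_real x0)); have := sqr_ge0 (`|x0| - 1); rewrite !expr2; nra.
  have n1 : `|x1| <= 1 + x1 ^+ 2.
    by rewrite -(real_normK (num_real x1)); have := sqr_ge0 (`|x1| - 1); rewrite !expr2; nra.
  by move: n0 n1 su; rewrite !expr2; lra.
have H3 : lam * s <= 32 * Lam * Q.
  have I : (Ez + Gz) * Q = (Ez * Gz - Fz ^+ 2) * (x0 ^+ 2 + x1 ^+ 2) +
     (Gz * x0 - Fz * x1) ^+ 2 + (Ez * x1 - Fz * x0) ^+ 2 by rewrite /Q; ring.
  have sx : s <= 16 * (x0 ^+ 2 + x1 ^+ 2) by rewrite !expr2.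
  have J : lam * s <= 16 * ((Ez + Gz) * Q).
    rewrite I; apply: (@le_trans _ _ ((Ez * Gz - Fz ^+ 2) * (16 * (x0 ^+ 2 + x1 ^+ 2)))).
      by apply: ler_pM => //; exact: ltW.
    by move: (sqr_ge0 (Gz * x0 - Fz * x1)) (sqr_ge0 (Ez * x1 - Fz * x0)); lra.
  have Q_ge0 : 0 <= Q.
    rewrite -(pmulr_rge0 _ (addr_gt0 Ez0 Gz0)).
    have : 0 < lam * s by rewrite mulr_gt0.
    by move: J; lra.
  apply: le_trans J _.
  have : (Ez + Gz) * Q <= (2 * Lam) * Q by apply: ler_wpM2r => //; lra.
  by lra.
have KN : K * (`|x0| + `|x1|) <= K * (2 + s) by exact: ler_wpM2l.
have H4 : 2 * alpha * Q < 2 * Lam + K * (2 + s) + 1 by lra.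
have Lam0 : 0 < Lam by lra.
have : alpha * (lam * s) < (2 * Lam + K * (2 + s) + 1) * (16 * Lam).
  apply: (@le_lt_trans _ _ (alpha * (32 * Lam * Q))); first by rewrite ler_pM2l.
  rewrite (_ : alpha * (32 * Lam * Q) = (2 * alpha * Q) * (16 * Lam)); last by ring.
  by rewrite ltr_pM2r // mulr_gt0.
by rewrite alE ltxx.
Qed.


Lemma disc_in_domain u : sq (u - u0) < rho ^+ 2 -> U u.
Proof. exact: sq_lt_ball. Qed.

Lemma f_within (A : set plane) : (A `<=` U) -> {within A, continuous f}.
Proof.
move=> AU; apply: continuous_in_subspaceT => u uA.
by apply: f_continuous; apply: AU; rewrite inE in uA.
Qed.

Lemma superlevel_compact (A : set plane) : (A `<=` U) -> compact A ->
  compact (A `&` [set u : plane | f u0 <= f u]).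
Proof.
move=> AU cA; have clA := compact_closed (@norm_hausdorff _ plane) cA.
apply: (subclosed_compact _ cA); last by move=> u [].
move=> u clu.
have Au : A u by apply: clA => B /clu [v [[Av _] Bv]]; exists v.
split=> //=; rewrite leNgt; apply/negP => lt.
have /clu [v [[_ /= le] lt']] : nbhs u (fun v => f v < f u0).
  by have /cvgr_lt := f_continuous (AU u Au); apply.
by move: (le_lt_trans le lt'); rewrite ltxx.
Qed.

(** A point [x0] near [u0] where [f] is not maximal is the centre of an open disc
    on which [f] is below its maximum, and which touches the contact set at some
    [y]: take [y] nearest to [x0] among the points where the maximum is
    attained. *)
Lemma touching_disc (x0 : plane) : sq (x0 - u0) < (rho / 3) ^+ 2 -> f x0 < f u0 ->
  exists y : plane, [/\ 0 < sq (y - x0), sq (y - x0) < (rho / 3) ^+ 2, f y = f u0 &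
    forall u : plane, sq (u - x0) < sq (y - x0) -> f u < f u0].
Proof.
move=> x0u0 fx0.
have sqC (u v : plane) : sq (u - v) = sq (v - u) by rewrite /sq /dot !mxE; ring.
pose D := [set u : plane | sq (u - x0) <= sq (u0 - x0)].
have DU : D `<=` U.
  move=> u /= Du; apply: disc_in_domain.
  move: Du x0u0; rewrite /D /= /sq /dot !mxE.
  set a := u 0 0; set b := u 0 1; set c := x0 0 0; set d := x0 0 1.
  set p := u0 0 0; set q := u0 0 1 => Du h.
  have := sqr_ge0 (a - c - (c - p)); have := sqr_ge0 (b - d - (d - q)).
  by move: Du h (mulr_gt0 rho0 rho0); rewrite !expr2; lra.
have Du0 : D u0 by rewrite /D /=.
have K_neq0 : (D `&` [set u : plane | f u0 <= f u]) !=set0 by exists u0; split=> /=.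
have cD := @disc_compact _ x0 (sq (u0 - x0)).
have cs := continuous_subspaceT (A := D `&` [set u : plane | f u0 <= f u]) (@sq_continuous R x0).
have [y yK ymin] := compact_EVT_min K_neq0 (superlevel_compact DU cD) cs.
rewrite inE in yK; case: yK => Dy fy.
have fyE : f y = f u0 by apply/eqP; rewrite eq_le fy f_max //; exact: DU.
exists y; split=> //.
- rewrite lt_neqAle sq_ge0 andbT eq_sym; apply/eqP => y0.
  have : y - x0 = 0 by apply: sq_eq0; rewrite y0.
  by move/subr0_eq => yx0; move: fx0; rewrite -yx0 fyE ltxx.
- by apply: le_lt_trans Dy _; rewrite sqC.
move=> u ltu; rewrite ltNge; apply/negP => fu.
suff /ymin : u \in D `&` [set u : plane | f u0 <= f u] by rewrite leNgt ltu.
by rewrite inE; split=> //; apply: le_trans (ltW ltu) _.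
Qed.

(** Otherwise there is a touching disc.  The disc of half the radius, internally
    tangent to it at [y], meets the contact set only at [y]; adding to [f] a small
    multiple of a Gaussian centred at its centre produces a function with an
    interior maximum near [y], which [no_barrier_max] excludes. *)
Lemma local_constancy : \forall u \near u0, f u = f u0.
Proof.
suff H (x0 : plane) : sq (x0 - u0) < (rho / 3) ^+ 2 -> f x0 = f u0.
  apply/nbhs_ballP; exists (rho / 6) => /=; first by rewrite divr_gt0.
  move=> x /ball_sq_lt h; apply: H; apply: lt_trans h _.
  by move: (mulr_gt0 rho0 rho0); rewrite !expr2; lra.
move=> x0u0; apply/eqP; rewrite eq_le f_max /=; last first.
  apply: disc_in_domain; apply: lt_trans x0u0 _.
  by move: (mulr_gt0 rho0 rho0); rewrite !expr2; lra.
rewrite leNgt; apply/negP => fx0.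
have [y [s0 sr fy inside]] := touching_disc x0u0 fx0.
set s := sq (y - x0) in s0 sr inside.
pose x : plane := 2^-1 *: (x0 + y).
have sqyx : sq (y - x) = s / 4 by rewrite /s /x /sq /dot !mxE; field.
(* the disc around x meets the contact set only at y *)
have strict (u : plane) : sq (u - x) <= s / 4 -> 0 < sq (u - y) -> f u < f u0.
  move=> ux uy; apply: inside; rewrite -/s.
  have : sq (u - x0) + sq (u - y) = 2 * sq (u - x) + s / 2.
    by rewrite /s /x /sq /dot !mxE; field.
  by lra.
pose D := [set u : plane | sq (u - y) <= s / 16].
have bounds u : D u -> s <= 16 * sq (u - x) /\ 8 * sq (u - x) <= 5 * s.
  rewrite /D /= => uy.
  have e1 : sq (u - x) + sq (u - y) >= s / 8.
    have <- : sq (y - x) / 2 = s / 8 by rewrite sqyx; field.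
    rewrite -subr_ge0; have -> : sq (u - x) + sq (u - y) - sq (y - x) / 2 =
      sq ((u - x) + (u - y)) / 2 by rewrite /sq /dot !mxE; field.
    by rewrite divr_ge0 // sq_ge0.
  have e2 : sq (u - x) <= 2 * (sq (u - y) + s / 4).
    rewrite -sqyx -subr_ge0; have -> : 2 * (sq (u - y) + sq (y - x)) - sq (u - x) =
      sq ((u - y) - (y - x)) by rewrite /sq /dot !mxE; ring.
    exact: sq_ge0.
  by move: e1 e2 uy; lra.
have DU : D `<=` U.
  move=> u; rewrite /D /= => uy; apply: disc_in_domain.
  have e1 : sq (u - u0) <= 3 * (sq (u - y) + s + sq (x0 - u0)).
    rewrite /s -subr_ge0.
    have -> : 3 * (sq (u - y) + sq (y - x0) + sq (x0 - u0)) - sq (u - u0) =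
      sq ((u - y) - (y - x0)) + sq ((u - y) - (x0 - u0)) + sq ((y - x0) - (x0 - u0)).
      by rewrite /sq /dot !mxE; ring.
    by apply: addr_ge0; [apply: addr_ge0|]; exact: sq_ge0.
  by move: e1 uy sr x0u0 (mulr_gt0 rho0 rho0); rewrite !expr2; lra.
have Dy : D y by rewrite /D /= subrr /sq /dot !mxE mulr0 addr0 divr_ge0 // ltW.
have Lam0 : 0 < Lam by apply: lt_le_trans (E_gt0 (DU y Dy)) (E_le (DU y Dy)).
pose alpha := (2 * Lam + K * (2 + s) + 1) * (16 * Lam) / (lam * s).
have al0 : 0 < alpha.
  rewrite divr_gt0 ?mulr_gt0 //.
  have : 0 <= K * (2 + s) by rewrite mulr_ge0 // addr_ge0 // ltW.
  by move: Lam0; lra.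
have alE : alpha * (lam * s) = (2 * Lam + K * (2 + s) + 1) * (16 * Lam).
  by rewrite /alpha divfK // mulf_neq0 // gt_eqF.
pose v u := expR (- alpha * sq (u - x)).
have v1 u : v u <= 1.
  by rewrite /v -expR0 ler_expR mulNr oppr_le0 mulr_ge0 ?sq_ge0 // ltW.
have v0 u : 0 < v u by exact: expR_gt0.
(* a uniform gap on the part of the small circle inside the disc around x *)
pose S := [set u : plane | sq (u - y) <= s / 16] `&` [set u : plane | s / 16 <= sq (u - y)] `&`
          [set u : plane | sq (u - x) <= s / 4].
have [eps eps0 gap] : exists2 eps, 0 < eps & forall u, S u -> f u + eps <= f u0.
  have [S0|S0] := pselect (S !=set0); last first.
    by exists 1 => // u Su; case: S0; exists u.
  have SU : S `<=` U by move=> u [[/DU]].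
  have cS : compact S.
    apply: subclosed_compact (@disc_compact _ y (s / 16)) _; last by move=> u [[]].
    apply: closedI; first apply: closedI.
    - exact: (compact_closed (@norm_hausdorff _ plane) (@disc_compact _ y _)).
    - have -> : [set u : plane | s / 16 <= sq (u - y)] = (fun u => sq (u - y)) @^-1` [set t | s / 16 <= t] by [].
      by apply: closed_comp; [move=> u _; exact: sq_continuous|exact: closed_ge].
    - exact: (compact_closed (@norm_hausdorff _ plane) (@disc_compact _ x _)).
  have [c cS' cmax] := compact_EVT_max S0 cS (f_within SU).
  rewrite inE in cS'; have [[c1 c2] c3] := cS'.
  have fc : f c < f u0 by apply: strict c3 _; apply: lt_le_trans c2; rewrite divr_gt0.
  exists (f u0 - f c); first by rewrite subr_gt0.
  by move=> u Su; have := cmax u; rewrite inE => /(_ Su); lra.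
pose w u := f u + eps * v u.
have cw : {within D, continuous w}.
  apply: continuous_in_subspaceT => u uD; rewrite inE in uD.
  have cv : {for u, continuous v}.
    apply: continuous_comp; last exact: continuous_expR.
    by apply: continuousM; [exact: cst_continuous|exact: sq_continuous].
  have ce : {for u, continuous (fun u => eps * v u)}.
    by apply: continuousM; [exact: cst_continuous|exact: cv].
  exact: continuousD (f_continuous (DU u uD)) ce.
have [z zD zmax] := compact_EVT_max (ex_intro _ y Dy) (@disc_compact _ y (s / 16)) cw.
rewrite inE in zD.
have wyz : w y <= w z by apply: zmax; rewrite inE.
have zy : sq (z - y) < s / 16.
  rewrite ltNge; apply/negP => zy.
  have [zx|zx] := lerP (sq (z - x)) (s / 4).
    have gz := gap z (conj (conj zD zy) zx).
    have : w z < w y.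
      rewrite /w fy; apply: (@le_lt_trans _ _ (f z + eps)).
        by rewrite lerD2l ler_piMr // ltW.
      by apply: le_lt_trans gz _; rewrite ltrDl mulr_gt0.
    by rewrite ltNge wyz.
  have : w z < w y.
    rewrite /w fy; apply: ler_ltD; first exact: f_max (DU z zD).
    by rewrite ltr_pM2l // /v ltr_expR sqyx !mulNr ltrN2 ltr_pM2l.
  by rewrite ltNge wyz.
have [b1 b2] := bounds z zD.
apply: (@no_barrier_max z x s eps alpha (DU z zD) s0 b1 b2 eps0 al0 alE).
have : \forall u \near z, sq (u - y) < s / 16.
  by have /cvgr_lt := @sq_continuous R y z; apply.
apply: filterS => u uy.
by apply: zmax; rewrite inE /D /=; exact: ltW.
Qed.

End StrongMaximumPrinciple.

(** The form of [local_constancy] used in charts: the domain is any open set, and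
    the ellipticity bounds come from continuity near [u0]. *)
Lemma strong_maximum_principle (R : realType) (U : set 'rV[R]_2) (lam Lam K : R)
    (u0 : 'rV[R]_2) (f E F G : 'rV[R]_2 -> R) f1 (f2 : 'I_2 -> 'I_2 -> 'rV[R]_2 -> R) :
  open U -> U u0 -> 0 < lam -> 0 <= K ->
  (forall u, U u -> {for u, continuous f}) ->
  partials U f f1 -> (forall j, partials U (f1 j) (fun i => f2 i j)) ->
  (\forall u \near u0, [/\ 0 < E u, lam <= E u * G u - F u ^+ 2, E u <= Lam, G u <= Lam &
     - K * (`|f1 0 u| + `|f1 1 u|) <=
       G u * f2 0 0 u - F u * (f2 0 1 u + f2 1 0 u) + E u * f2 1 1 u]) ->
  (\forall u \near u0, f u <= f u0) ->
  \forall u \near u0, f u = f u0.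
Proof.
move=> oU Uu0 lam0 K0 cf pf pf1 cond fmax.
have nU : nbhs u0 U by exact: open_nbhs_nbhs.
have nb := @filterI _ (nbhs u0) (nbhs_filter u0) _ _ nU
  (@filterI _ (nbhs u0) (nbhs_filter u0) _ _ cond fmax).
case/nbhs_ballP: nb => r /= r0 Hr.
apply: (@local_constancy R r lam Lam K u0 f E F G f1 f2) => //.
- by move=> u /Hr [/cf].
- by move=> u /Hr [Uu _] i; exact: pf.
- by move=> j u /Hr [Uu _] i; exact: pf1.
- by move=> u /Hr [_ [[]]].
- by move=> u /Hr [_ [[]]].
- by move=> u /Hr [_ [[]]].
- by move=> u /Hr [_ [[]]].
- by move=> u /Hr [_ [[]]].
- by move=> u /Hr [_ [_]].
Qed.

(** * Linear algebra of an adapted frame of the product space *)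

Section MetricAlgebra.
Variables (R : realType) (kappa : R).
Local Notation space := ('rV[R]_3 * R)%type.
Implicit Types (q v w : 'rV[R]_3) (V W : space).
Local Notation form := (form3 kappa).
Local Notation met := (metric kappa).

Lemma form3C v w : form v w = form w v.
Proof. by rewrite /form3; ring. Qed.

Lemma form3_linear k v w q : form (k *: v + w) q = k * form v q + form w q.
Proof. by rewrite /form3 !mxE; ring. Qed.

Lemma metricC V W : met V W = met W V.
Proof. by rewrite /metric form3C; ring. Qed.

Lemma metric_linear k V W Z : met (k *: V + W) Z = k * met V Z + met W Z.
Proof. by rewrite /metric /= form3_linear -[k *: V.2]/(k * V.2); ring. Qed.

Lemma metric0l Z : met 0 Z = 0.
Proof. by have := metric_linear 1 0 0 Z; rewrite scaler0 addr0 mul1r; lra. Qed.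

Lemma metricZl k V Z : met (k *: V) Z = k * met V Z.
Proof. by rewrite -[k *: V]addr0 metric_linear metric0l addr0. Qed.

Lemma metric_dz V : met V (dz R) = V.2.
Proof. by rewrite /metric /form3 /= !mxE !mulr0 !addr0 add0r mulr1. Qed.

Lemma rV3_eq0 v : v 0 (inord 0) = 0 -> v 0 (inord 1) = 0 -> v 0 (inord 2) = 0 -> v = 0.
Proof.
move=> v0 v1 v2; apply/rowP => i; rewrite mxE.
rewrite -(inord_val i); case: i => [[|[|[|i]]] i3] //=.
Qed.

Hypothesis hkappa : kappa = -1 \/ kappa = 1.

(** Tangent vectors of the sphere, and of the upper sheet of the hyperboloid, are
    spacelike.  In the Lorentzian case this is the reversed Cauchy-Schwarz
    inequality, made explicit by a Lagrange identity. *)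
Lemma form3_posdef q v : form q q = kappa -> form q v = 0 ->
  0 <= form v v /\ (form v v <= 0 -> v = 0).
Proof.
rewrite /form3.
set q0 := q 0 _; set q1 := q 0 _; set q2 := q 0 _.
set v0 := v 0 _; set v1 := v 0 _; set v2 := v 0 _.
have fin : v0 = 0 -> v1 = 0 -> v2 = 0 -> v = 0 by exact: rV3_eq0.
case: hkappa => ->; rewrite ?mulN1r ?mul1r => qq qv; last first.
  split; first by nra.
  by move=> vv; apply: fin; nra.
have q2E : q2 ^+ 2 = 1 + q0 ^+ 2 + q1 ^+ 2 by rewrite !expr2; lra.
have cs : (q2 * v2) ^+ 2 + (q0 * v1 - q1 * v0) ^+ 2 =
    (q0 ^+ 2 + q1 ^+ 2) * (v0 ^+ 2 + v1 ^+ 2).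
  by rewrite (_ : q2 * v2 = q0 * v0 + q1 * v1); [ring|lra].
have key : q2 ^+ 2 * (v0 * v0 + v1 * v1 + - (v2 * v2)) =
    (v0 ^+ 2 + v1 ^+ 2) + (q0 * v1 - q1 * v0) ^+ 2.
  have -> : q2 ^+ 2 * (v0 * v0 + v1 * v1 + - (v2 * v2)) =
    q2 ^+ 2 * (v0 ^+ 2 + v1 ^+ 2) - (q2 * v2) ^+ 2 by ring.
  by rewrite {1}q2E; lra.
have q2p : 0 < q2 ^+ 2 by rewrite q2E; have := sqr_ge0 q0; have := sqr_ge0 q1; lra.
have s0 := sqr_ge0 v0; have s1 := sqr_ge0 v1; have s2 := sqr_ge0 (q0 * v1 - q1 * v0).
split; first by rewrite -(pmulr_rge0 _ q2p) key; lra.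
move=> vv; have : q2 ^+ 2 * (v0 * v0 + v1 * v1 + - (v2 * v2)) <= 0.
  by rewrite pmulr_rle0.
rewrite key => le0.
have v00 : v0 = 0 by apply/eqP; rewrite -sqrf_eq0; apply/eqP; lra.
have v10 : v1 = 0 by apply/eqP; rewrite -sqrf_eq0; apply/eqP; lra.
apply: fin => //; move: qv; rewrite v00 v10 !mulr0 !add0r => /eqP.
rewrite oppr_eq0 mulf_eq0 => /orP[/eqP q20|/eqP//].
by move: q2p; rewrite q20 expr0n ltxx.
Qed.

Lemma metric_linearr k V W Z : met Z (k *: V + W) = k * met Z V + met Z W.
Proof. by rewrite metricC metric_linear !(metricC Z). Qed.

Lemma metricZr k V Z : met Z (k *: V) = k * met Z V.
Proof. by rewrite metricC metricZl (metricC Z). Qed.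

Lemma metric_comb k l V W Z : met Z (k *: V + l *: W) = k * met Z V + l * met Z W.
Proof. by rewrite metric_linearr metricZr. Qed.

(** The pointwise data of an immersed surface: the position [q], the two
    coordinate tangent vectors, and the unit normal.  Together with [(q, 0)] they
    form a basis of the ambient four-dimensional space. *)
Definition frame (q : 'rV[R]_3) (X0 X1 N : space) : Prop :=
  [/\ [/\ form q q = kappa, form q X0.1 = 0, form q X1.1 = 0 & form q N.1 = 0],
      [/\ met N N = 1, met X0 N = 0 & met X1 N = 0] &
      forall a b : R, a *: X0 + b *: X1 = 0 -> a = 0 /\ b = 0].

Variables (q : 'rV[R]_3) (X0 X1 N : space).
Hypothesis fr : frame q X0 X1 N.

Let qq : form q q = kappa. Proof. by case: fr => [[]]. Qed.
Let qX0 : form q X0.1 = 0. Proof. by case: fr => [[]]. Qed.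
Let qX1 : form q X1.1 = 0. Proof. by case: fr => [[]]. Qed.
Let qN : form q N.1 = 0. Proof. by case: fr => [[]]. Qed.
Let NN : met N N = 1. Proof. by case: fr => [_ []]. Qed.
Let X0N : met X0 N = 0. Proof. by case: fr => [_ []]. Qed.
Let X1N : met X1 N = 0. Proof. by case: fr => [_ []]. Qed.
Let free : forall a b : R, a *: X0 + b *: X1 = 0 -> a = 0 /\ b = 0.
Proof. by case: fr => [_ _]. Qed.

Lemma metric_posdef V : form q V.1 = 0 -> 0 <= met V V /\ (met V V <= 0 -> V = 0).
Proof.
case: V => v s /= qv; rewrite /metric /=.
have [p0 p1] := form3_posdef qq qv.
have s0 : 0 <= s * s by rewrite -expr2 sqr_ge0.
split; first lra.
move=> le; have -> : v = 0 by apply: p1; lra.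
have /eqP : s * s = 0 by lra.
by rewrite mulf_eq0 orbb => /eqP ->.
Qed.

(** The vectors [X0], [X1], [N] and [(q, 0)] are linearly independent, hence a
    basis; so [V] is a combination of vectors orthogonal to it, that is
    [metric V V = 0], and [V] vanishes because it is tangent. *)
Lemma frame_spans V : met V X0 = 0 -> met V X1 = 0 -> met V N = 0 ->
  form V.1 q = 0 -> V = 0.
Proof.
move=> VX0 VX1 VN Vq.
pose enc W : 'rV[R]_(3 + 1) := row_mx W.1 (const_mx W.2).
have encL k W Z : enc (k *: W + Z) = k *: enc W + enc Z.
  rewrite /enc scale_row_mx add_row_mx /=; congr row_mx.
  by apply/rowP => i; rewrite !mxE.
have enc_inj W : enc W = 0 -> W = 0.
  rewrite /enc -row_mx0 => /eq_row_mx [W1 W2].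
  by case: W W1 W2 => w s /= -> /rowP /(_ 0); rewrite !mxE => ->.
pose B : 'M[R]_4 := col_mx (col_mx (col_mx (enc X0) (enc X1)) (enc N)) (enc (q, 0)).
have mulB (u : 'rV[R]_4) : exists a b c d, u *m B = enc (a *: X0 + (b *: X1 + (c *: N + (d *: (q, 0) + 0))))
    /\ (a = 0 -> b = 0 -> c = 0 -> d = 0 -> u = 0).
  pose u3 : 'rV[R]_(2 + 1) := @lsubmx R 1 3 1 u; pose d : 'M[R]_1 := @rsubmx R 1 3 1 u.
  pose u2 : 'rV[R]_(1 + 1) := lsubmx u3; pose c := rsubmx u3.
  pose a := lsubmx u2; pose b := rsubmx u2.
  have -> : u = row_mx (row_mx (row_mx a b : 'rV_2) c : 'rV_3) d by rewrite !hsubmxK.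
  exists (a 0 0), (b 0 0), (c 0 0), (d 0 0); split; last first.
    move=> a0 b0 c0 d0; rewrite [a]mx11_scalar [b]mx11_scalar [c]mx11_scalar [d]mx11_scalar.
    by rewrite a0 b0 c0 d0 !raddf0 !row_mx0.
  rewrite /B (@mul_row_col _ 1 3 1) (@mul_row_col _ 1 2 1) (@mul_row_col _ 1 1 1).
  rewrite {1}[a]mx11_scalar {1}[b]mx11_scalar {1}[c]mx11_scalar {1}[d]mx11_scalar.
  have enc0 : enc 0 = 0.
    by rewrite /enc /= (_ : const_mx 0 = 0) ?row_mx0 //; apply/rowP => i; rewrite !mxE.
  by rewrite !mul_scalar_mx !encL enc0 addr0 !addrA.
have Bfree : row_free B.
  apply: inj_row_free => u; have [a [b [c [d [-> H]]]]] := mulB u.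
  move=> /enc_inj W0.
  have fW : form (a *: X0 + (b *: X1 + (c *: N + (d *: (q, 0) + 0)))).1 q = 0.
    by rewrite W0 /form3 /= !mxE; ring.
  have d0 : d = 0.
    move: fW; rewrite /= !form3_linear !(form3C _ q) qX0 qX1 qN qq.
    have -> : form q 0 = 0 by rewrite /form3 !mxE; ring.
    rewrite !mulr0 !add0r addr0 => /eqP; rewrite mulf_eq0 => /orP[/eqP//|/eqP k0].
    by case: hkappa; rewrite k0 => /eqP; rewrite eq_sym ?oppr_eq0 oner_eq0.
  have c0 : c = 0.
    have := metric0l N; rewrite -W0 d0 !metric_linear X0N X1N NN metric0l.
    by rewrite mul0r !mulr0 !add0r !addr0 mulr1.
  have [a0 b0] : a = 0 /\ b = 0.
    by apply: free; move: W0; rewrite c0 d0 !scale0r !addr0.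
  exact: H.
have BU : B \in unitmx by rewrite -row_free_unit.
have [a [b [c [d [E _]]]]] := mulB (enc V *m invmx B).
have VE : V = a *: X0 + (b *: X1 + (c *: N + (d *: (q, 0) + 0))).
  apply/eqP; rewrite -subr_eq0; apply/eqP/enc_inj.
  by rewrite addrC -scaleN1r encL -E mulmxKV // scaleN1r addNr.
apply: (metric_posdef _).2; first by rewrite form3C.
have qV : met (q, 0) V = 0 by rewrite /metric /= form3C Vq mul0r addr0.
rewrite {1}VE !metric_linear metric0l qV (metricC X0) (metricC X1) (metricC N).
by rewrite VX0 VX1 VN !mulr0 !addr0.
Qed.

Local Notation E := (met X0 X0).
Local Notation F := (met X0 X1).
Local Notation G := (met X1 X1).
Local Notation D := (E * G - F ^+ 2).
Local Notation nu := (met N (dz R)).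

Lemma first_form_posdef : 0 < E /\ 0 < D.
Proof.
have E0 : 0 < E.
  rewrite ltNge; apply/negP => le.
  have X00 := (metric_posdef qX0).2 le.
  have [] : (1 : R) = 0 /\ (0 : R) = 0 by apply: free; rewrite X00 scaler0 scale0r addr0.
  by move/eqP; rewrite oner_eq0.
split=> //; rewrite -(pmulr_rgt0 _ E0) ltNge; apply/negP => le.
pose W : space := (- F) *: X0 + E *: X1.
have WW : met W W = E * D.
  rewrite /W metric_linear metricZl !metric_linearr !metricZr.
  by rewrite (metricC X1 X0); ring.
have qW : form q W.1 = 0.
  by rewrite form3C /W /= form3_linear -[E *: X1.1]addr0 form3_linear
    -(form3C q) qX0 -(form3C q) qX1 /form3 !mxE; ring.
have W0 : W = 0 by apply: (metric_posdef qW).2; rewrite WW.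
by have [_ E00] := free W0; move: E0; rewrite E00 ltxx.
Qed.

(** The vertical field is the tangential gradient of the height plus [nu] times
    the normal.  Multiplied by the determinant [D] of the first fundamental
    form, the coefficients of the gradient are polynomial. *)
Lemma dz_decomposition Y : let h0 := X0.2 in let h1 := X1.2 in
  D * Y.2 = (G * h0 - F * h1) * met Y X0 + (E * h1 - F * h0) * met Y X1
            + D * nu * met Y N.
Proof.
move=> h0 h1.
pose a := G * h0 - F * h1; pose b := E * h1 - F * h0.
pose V : space := (- a) *: X0 + ((- b) *: X1 + ((- (D * nu)) *: N + D *: dz R)).
have VE Z : met V Z = - a * met X0 Z + (- b * met X1 Z + (- (D * nu) * met N Z + D * met (dz R) Z)).
  by rewrite /V !metric_linear metricZl.
have V0 : V = 0.
  have [nX0 nX1] : met N X0 = 0 /\ met N X1 = 0 by rewrite metricC X0N metricC X1N.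
  apply: frame_spans; rewrite ?VE.
  - rewrite nX0 (metricC X1 X0) (metricC (dz R)) !metric_dz -/h0 /a /b; ring.
  - rewrite nX1 (metricC (dz R)) !metric_dz -/h1 /a /b; ring.
  - by rewrite X0N X1N NN (metricC (dz R) N); ring.
  rewrite /V /= !form3_linear -[D *: 0]addr0 form3_linear.
  by rewrite !(form3C _ q) qX0 qX1 qN /form3 !mxE; ring.
have := metric0l Y; rewrite -V0 VE (metricC _ Y) (metricC _ Y) (metricC _ Y) (metricC _ Y) !metric_dz.
by rewrite /a /b; lra.
Qed.

Lemma gradient_norm : let h0 := X0.2 in let h1 := X1.2 in
  D * (1 - nu ^+ 2) = (G * h0 - F * h1) * h0 + (E * h1 - F * h0) * h1.
Proof.
move=> h0 h1; have := dz_decomposition (dz R).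
rewrite (metricC (dz R) X0) (metricC (dz R) X1) (metricC (dz R) N) !metric_dz /=.
by rewrite -/h0 -/h1; lra.
Qed.

Lemma normal_vertical : X0.2 = 0 -> X1.2 = 0 -> N.1 = 0.
Proof.
move=> h0 h1; have := gradient_norm; have [_ D0] := first_form_posdef.
rewrite /= h0 h1 !mulr0 addr0 metric_dz => /eqP.
rewrite mulf_eq0 gt_eqF //= subr_eq0 => /eqP nu1.
apply: (form3_posdef qq qN).2.
by move: NN; rewrite /metric -expr2; lra.
Qed.

(** On a horizontal surface the normal is vertical, so a horizontal vector
    orthogonal to the surface is a multiple of the position. *)
Lemma normal_line y : X0.2 = 0 -> X1.2 = 0 ->
  met (y, 0) X0 = 0 -> met (y, 0) X1 = 0 -> y = (kappa * form q y) *: q.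
Proof.
move=> h0 h1 y0 y1; have N0 := normal_vertical h0 h1.
set lam := kappa * form q y.
have qX V : form q V.1 = 0 -> met (q, 0) V = 0.
  by rewrite /metric /= => ->; rewrite mul0r addr0.
have f0 v : form v 0 = 0 by rewrite /form3 !mxE; ring.
pose V : space := (- lam) *: (q, 0) + (y, 0).
have V0 : V = 0.
  apply: frame_spans; rewrite /V ?metric_linear.
  - by rewrite y0 qX ?mulr0 ?addr0.
  - by rewrite y1 qX ?mulr0 ?addr0.
  - rewrite qX; last by rewrite N0 f0.
    by rewrite /metric /= N0 f0 mulr0 mul0r !addr0.
  rewrite /= form3_linear qq (form3C y) /lam.
  by case: hkappa => ->; ring.
by have := congr1 fst V0; rewrite /V /= scaleNr addrC => /eqP; rewrite subr_eq0 => /eqP.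
Qed.

(** The trace of the coordinate Hessian of the height, up to the factor [D]:
    first order terms in the gradient, plus [2 nu m], where [m] is the mean
    curvature.  It is the identity Laplacian h = 2 H nu in coordinates, the
    Christoffel symbols being hidden in the products [met Yij Xk]. *)
Lemma height_hessian Y00 Y01 Y10 Y11 m : let h0 := X0.2 in let h1 := X1.2 in
  2 * m * D = G * met Y00 N - F * (met Y01 N + met Y10 N) + E * met Y11 N ->
  D * (G * Y00.2 - F * (Y01.2 + Y10.2) + E * Y11.2) =
  (G * h0 - F * h1) *
    (G * met Y00 X0 - F * (met Y01 X0 + met Y10 X0) + E * met Y11 X0) +
  (E * h1 - F * h0) *
    (G * met Y00 X1 - F * (met Y01 X1 + met Y10 X1) + E * met Y11 X1) +
  2 * D ^+ 2 * (nu * m).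
Proof.
move=> h0 h1 tr.
have dec Y : D * Y.2 = (G * h0 - F * h1) * met Y X0 + (E * h1 - F * h0) * met Y X1
            + D * nu * met Y N by exact: dz_decomposition.
rewrite (_ : D * _ = G * (D * Y00.2) - F * (D * Y01.2 + D * Y10.2)
   + E * (D * Y11.2)); last by ring.
rewrite !dec (_ : 2 * D ^+ 2 * (nu * m) = D * nu * (2 * m * D)); last by ring.
by rewrite tr; ring.
Qed.

Lemma angle_le1 : nu ^+ 2 <= 1.
Proof.
have [p _] := form3_posdef qq qN.
by have := NN; rewrite metric_dz /metric expr2; lra.
Qed.


Lemma mean_curvature_trace (X : 'rV[R]_2 -> space) u :
  pderive 0 X u = X0 -> pderive 1 X u = X1 ->
  let Y i j := pderive i (pderive j X) u in
  2 * mean_curvature kappa X N u * D =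
  G * met (Y 0 0) N - F * (met (Y 0 1) N + met (Y 1 0) N) + E * met (Y 1 1) N.
Proof.
move=> dX0 dX1 Y; have [_ D0] := first_form_posdef.
have D_neq0 : D != 0 by rewrite gt_eqF.
pose J : 'M[R]_2 := D^-1 *: \matrix_(i, j)
  (if i == 0 then if j == 0 then G else - F else if j == 0 then - F else E).
have sum2 (g : 'I_2 -> R) : \sum_i g i = g 0 + g 1.
  by rewrite big_ord_recl big_ord1; congr (_ + g _); exact: val_inj.
have ord2 (i : 'I_2) : i = 0 \/ i = 1.
  by case: i => [[|[|i]] i2] //; [left|right]; exact: val_inj.
have JI : J *m first_form kappa X u = 1%:M.
  apply/matrixP => i j; rewrite !mxE sum2 !mxE.
  by case: (ord2 i) => ->; case: (ord2 j) => ->; rewrite /= ?dX0 ?dX1 ?(metricC X1 X0) //=; field.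
have [_ IU] := mulmx1_unit JI.
have invE : invmx (first_form kappa X u) = J.
  by rewrite -[LHS]mul1mx -JI mulmxK.
have SE i j : second_form kappa X N u i j = met (Y i j) N by rewrite mxE.
rewrite /mean_curvature /shape_operator invE.
move: (second_form kappa X N u) SE => S SE.
have ME i : (J *m S) i i = J i 0 * met (Y 0 i) N + J i 1 * met (Y 1 i) N.
  by rewrite mxE sum2 !SE.
have J00 : J 0 0 = D^-1 * G by rewrite !mxE.
have J01 : J 0 1 = D^-1 * - F by rewrite !mxE.
have J10 : J 1 0 = D^-1 * - F by rewrite !mxE.
have J11 : J 1 1 = D^-1 * E by rewrite !mxE.
rewrite /mxtrace sum2 !ME J00 J01 J10 J11.
move: (Y 0 0) (Y 0 1) (Y 1 0) (Y 1 1) => Y00 Y01 Y10 Y11.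
by field.
Qed.

End MetricAlgebra.

(** * Analytic preliminaries for the height function *)

Section Functionals.
Variables (R : realType) (kappa : R).
Local Notation space := ('rV[R]_3 * R)%type.

Lemma coordinate_continuous k : continuous (fun P : space => P.1 0 k).
Proof.
move=> P; apply: (@continuous_comp _ _ _ fst (fun v : 'rV[R]_3 => v 0 k)).
  exact: cvg_fst.
exact: coord_continuous.
Qed.

Lemma functional_coordinate k : functional (fun P : space => P.1 0 k).
Proof. by split; [move=> c P Q; rewrite /= !mxE|exact: coordinate_continuous]. Qed.

Lemma functional_height : functional (fun P : space => P.2).
Proof. by split=> // P; exact: cvg_snd. Qed.

Lemma metric_continuous (T : topologicalType) (f g : T -> space) (p : T) :
  {for p, continuous f} -> {for p, continuous g} ->
  {for p, continuous (fun p => metric kappa (f p) (g p))}.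
Proof.
move=> cf cg.
have cM (a b : space -> R) : continuous a -> continuous b ->
    {for p, continuous (fun p => a (f p) * b (g p))}.
  move=> ca cb; have cfa : {for p, continuous (a \o f)}.
    by apply: continuous_comp; [exact: cf|exact: ca].
  have cgb : {for p, continuous (b \o g)} by apply: continuous_comp; [exact: cg|exact: cb].
  exact: continuousM cfa cgb.
have ck k := cM _ _ (@coordinate_continuous k) (@coordinate_continuous k).
have cs := cM _ _ functional_height.2 functional_height.2.
have c2 : {for p, continuous (fun p => kappa * ((f p).1 0 (inord 2) * (g p).1 0 (inord 2)))}.
  by apply: continuousM; [exact: cst_continuous|exact: ck].
exact: (continuousD (continuousD (continuousD (ck (inord 0)) (ck (inord 1))) c2) cs).
Qed.

Lemma functional_metric V : functional (fun P => metric kappa P V).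
Proof.
split; first by move=> c P Q; exact: metric_linear.
move=> P; apply: (@metric_continuous _ id (cst V)); first exact: cvg_id.
exact: cst_continuous.
Qed.

Lemma C2_functional (U : set 'rV[R]_2) (X : 'rV[R]_2 -> space) L :
  Ck_on 2 U X -> functional L ->
  partials U (L \o X) (fun i => L \o pderive i X) /\
  forall j, partials U (L \o pderive j X) (fun i => L \o pderive i (pderive j X)).
Proof.
move=> [_ C2] fL; split=> [u Uu i|j u Uu i].
  have [dX [cX _]] := C2 i; split.
    by apply: is_derive_functional => //; apply: derivableP; exact: dX.
  by apply: continuous_comp; [exact: cX|exact: fL.2].
have [_ [_ C1]] := C2 j; have [dX [cX _]] := C1 i; split.
  by apply: is_derive_functional => //; apply: derivableP; exact: dX.
by apply: continuous_comp; [exact: cX|exact: fL.2].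
Qed.

End Functionals.

Lemma scale_operator (R : comPzRingType) (E F G t a b c d : R) :
  G * (t * a) - F * (t * b + t * c) + E * (t * d) = t * (G * a - F * (b + c) + E * d).
Proof. by ring. Qed.

Lemma linear_bound_at_zero (R : realType) (H : R -> R) (s : R) :
  C1_on_segment H -> -1 <= s <= 1 -> H s = 0 ->
  exists2 C, 0 <= C & \forall y \near s, -1 <= y <= 1 -> `|H y| <= C * `|y - s|.
Proof.
move=> [df [_ dH]] s1 Hs; exists (`|df s| + 1); first by rewrite addr_ge0.
have /cvgrPdist_lt /(_ 1 ltr01) := dH s s1.
rewrite near_withinE => d; have := d; rewrite near_withinE.
apply: filterS => y yd y1.
have [->|ys] := eqVneq y s; first by rewrite Hs subrr normr0 mulr0.
have ys0 : y - s != 0 by rewrite subr_eq0.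
have y1' : `[-1, 1]%classic y by rewrite /= in_itv.
have {}yd := yd ys y1'.
rewrite -[H y](subr0) -Hs -[X in `|X|](divfK ys0) normrM ler_wpM2r //.
rewrite -[X in `|X| <= _](subrK (df s)); apply: le_trans (ler_normD _ _) _.
by rewrite addrC lerD2l distrC ltW.
Qed.

(** The right-hand side of [height_hessian] is bounded by a multiple of the
    gradient when the mean curvature is [O(1 - n^2)], because [1 - n^2] is the
    squared length of the gradient of the height. *)
Lemma height_estimate (R : realFieldType) (e f g p0 p1 l d n m h0 h1 B C lam : R) :
  `|e| <= B -> `|f| <= B -> `|g| <= B -> `|p0| <= B -> `|p1| <= B ->
  `|h0| <= B -> `|h1| <= B -> 0 < lam -> lam <= d -> 0 <= C -> `|n| <= 1 ->
  d * (1 - n ^+ 2) = (g * h0 - f * h1) * h0 + (e * h1 - f * h0) * h1 ->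
  d * l = (g * h0 - f * h1) * p0 + (e * h1 - f * h0) * p1 + 2 * d ^+ 2 * (n * m) ->
  `|m| <= C * (1 - n ^+ 2) ->
  `|l| <= (2 * B ^+ 2 / lam + 4 * C * B ^+ 2) * (`|h0| + `|h1|).
Proof.
move=> eB fB gB p0B p1B h0B h1B lam0 lamd C0 n1 grad eqn mC.
have d0 : 0 < d by apply: lt_le_trans lamd.
have B0 : 0 <= B by apply: le_trans eB.
set s := `|h0| + `|h1|; have s0 : 0 <= s by rewrite addr_ge0.
have lin (a b x y : R) : `|a| <= B -> `|b| <= B -> `|a * x - b * y| <= B * (`|x| + `|y|).
  move=> aB bB; apply: le_trans (ler_normB _ _) _.
  by rewrite !normrM mulrDr lerD // ler_wpM2r.
have a0 : `|g * h0 - f * h1| <= B * s by exact: lin.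
have a1 : `|e * h1 - f * h0| <= B * s by rewrite /s [X in B * X]addrC; exact: lin.
have Bs0 : 0 <= B * s by rewrite mulr_ge0.
have bound x y : `|x| <= B -> `|y| <= B ->
    `|(g * h0 - f * h1) * x + (e * h1 - f * h0) * y| <= 2 * B ^+ 2 * s.
  move=> xB yB; apply: le_trans (ler_normD _ _) _; rewrite !normrM.
  have -> : 2 * B ^+ 2 * s = B * s * B + B * s * B by ring.
  by apply: lerD; apply: ler_pM.
have dg : d * (1 - n ^+ 2) <= 2 * B ^+ 2 * s.
  by rewrite grad; apply: le_trans (ler_norm _) _; exact: bound.
have nm : `|n * m| <= C * (1 - n ^+ 2).
  by apply: le_trans mC; rewrite normrM ler_piMl.
have dl : d * `|l| <= 2 * B ^+ 2 * s + d * (4 * C * B ^+ 2 * s).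
  rewrite -[X in X * `|l|](gtr0_norm d0) -normrM eqn.
  apply: le_trans (ler_normD _ _) _; apply: lerD; first exact: bound.
  have d2 : 0 <= 2 * d ^+ 2 by rewrite mulr_ge0 // sqr_ge0.
  rewrite normrM (ger0_norm d2).
  apply: le_trans (ler_wpM2l d2 nm) _.
  have -> : 2 * d ^+ 2 * (C * (1 - n ^+ 2)) = d * (2 * C * (d * (1 - n ^+ 2))) by ring.
  rewrite ler_pM2l //.
  have -> : 4 * C * B ^+ 2 * s = 2 * C * (2 * B ^+ 2 * s) by ring.
  by rewrite ler_wpM2l // mulr_ge0.
rewrite -(ler_pM2l d0); apply: le_trans dl _.
rewrite [X in _ <= X](_ : _ = d * (2 * B ^+ 2 / lam * s) + d * (4 * C * B ^+ 2 * s)); last by ring.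
apply: lerD => //.
have -> : d * (2 * B ^+ 2 / lam * s) = (d / lam) * (2 * B ^+ 2 * s) by field; rewrite gt_eqF.
have : 0 <= 2 * B ^+ 2 * s by rewrite !mulr_ge0 // sqr_ge0.
by move=> /ler_peMl; apply; rewrite ler_pdivlMr // mul1r.
Qed.

Lemma sum_bounds (R : realFieldType) (e f g p q a b B : R) :
  `|e| + `|f| + (`|g| + `|p|) + (`|q| + (`|a| + `|b|)) <= B ->
  [/\ `|e| <= B, `|f| <= B & `|g| <= B] /\
  [/\ `|p| <= B, `|q| <= B, `|a| <= B & `|b| <= B].
Proof.
move: (normr_ge0 e) (normr_ge0 f) (normr_ge0 g) (normr_ge0 p) (normr_ge0 q).
by move: (normr_ge0 a) (normr_ge0 b) => *; repeat split; lra.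
Qed.

(** Since [eps] is a sign and [eps * n] lies between [0] and [1], one has
    [n ^+ 2 <= eps * n]. *)
Lemma angle_defect (R : realFieldType) (n eps : R) :
  n ^+ 2 <= 1 -> eps ^+ 2 = 1 -> 0 < eps * n -> `|n - eps| <= 1 - n ^+ 2.
Proof.
move=> n1 e1 en0.
have e2 : (eps * n) ^+ 2 = n ^+ 2 by rewrite exprMn e1 mul1r.
have en1 : eps * n <= 1 by rewrite expr2 in e2; nra.
have -> : `|n - eps| = 1 - eps * n.
  have -> : `|n - eps| = `|eps| * `|n - eps|.
    by have := e1; rewrite -(real_normK (num_real eps)) => /eqP;
      rewrite sqrp_eq1 // => /eqP ->; rewrite mul1r.
  rewrite -normrM mulrBr -expr2 e1 distrC ger0_norm //; lra.
by rewrite -e2 expr2; nra.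
Qed.

(** * The height function of an H-surface *)

Section Charts.
Variables (R : realType) (T : topologicalType) (x : local_param R T).

Lemma chart_open_nbhs u : lp_dom x u -> nbhs u (lp_dom x).
Proof. by move=> Uu; apply: open_nbhs_nbhs; split=> //; exact: lp_open_dom. Qed.

(** Charts are homeomorphisms onto open sets, so local statements on the surface
    may be checked in a chart. *)
Lemma near_chart (P : T -> Prop) u : lp_dom x u ->
  (\forall p \near x u, P p) <-> (\forall v \near u, P (x v)).
Proof.
move=> Uu; split; first by move=> /(lp_map_continuous Uu).
move=> Pu.
have ixu : (x @` lp_dom x) (x u) by exists u.
have im : \forall p \near x u, (x @` lp_dom x) p.
  by apply: open_nbhs_nbhs; split=> //; exact: lp_open_image.
have cinv := lp_inv_continuous ixu.
have Pu' : nbhs (lp_inv x (x u)) (fun v => P (x v)) by rewrite lp_mapK.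
have : \forall p \near x u, P (x (lp_inv x p)) by exact: cinv Pu'.
apply: filterS2 im => p [v Uv <-].
by rewrite lp_mapK.
Qed.

Lemma continuous_chart (V : topologicalType) (f : T -> V) u : lp_dom x u ->
  {for u, continuous (f \o x)} -> {for x u, continuous f}.
Proof. by move=> Uu cf B fB; apply/(near_chart (fun p => B (f p)) Uu)/cf. Qed.

End Charts.

Section Height.
Variables (R : realType) (kappa : R) (T : topologicalType).
Variables (A : set (local_param R T)) (H : R -> R) (psi eta : T -> 'rV[R]_3 * R).
Hypothesis hkappa : kappa = -1 \/ kappa = 1.
Hypothesis hsurf : H_surface kappa A H psi eta.
Local Notation met := (metric kappa).

Section OneChart.
Variable x : local_param R T.
Hypothesis Ax : A x.
Let X := psi \o x.
Let U := lp_dom x.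
Let nu u := angle kappa eta (x u).
Let h u := (X u).2.

Lemma chart_C2 : Ck_on 2 U X.
Proof. by have [[_ /(_ x Ax) []]] := hsurf. Qed.

Lemma chart_position u : form3 kappa (X u).1 (X u).1 = kappa.
Proof. by have [[/(_ (x u)) []]] := hsurf. Qed.

Lemma position_orthogonal u i : U u -> form3 kappa (X u).1 (pderive i X u).1 = 0.
Proof.
move=> Uu; pose c k u := (X u).1 0 k.
have dc k := ((C2_functional chart_C2 (functional_coordinate R k)).1 u Uu i).1.
pose f v := c (inord 0) v * c (inord 0) v + c (inord 1) v * c (inord 1) v +
  kappa * (c (inord 2) v * c (inord 2) v).
have Df := is_deriveD (is_deriveD (is_deriveM (dc (inord 0)) (dc (inord 0)))
  (is_deriveM (dc (inord 1)) (dc (inord 1))))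
  (is_deriveZ kappa (is_deriveM (dc (inord 2)) (dc (inord 2)))).
have fE : f = cst kappa by apply/funext => v; exact: chart_position.
case: Df => _; rewrite [X in derive X](_ : _ = f) // fE derive_cst.
rewrite /form3 -![_ *: _]/(_ * _) /=; lra.
Qed.

Lemma chart_frame u : U u ->
  frame kappa (X u).1 (pderive 0 X u) (pderive 1 X u) (eta (x u)).
Proof.
move=> Uu; have [[_ /(_ x Ax) [_ imm]] [_ un] _] := hsurf.
have [tN NN XN] := un x Ax u Uu.
split; first by split; [exact: chart_position|exact: position_orthogonal|exact: position_orthogonal|].
  by split.
move=> a b ab.
pose v : 'rV[R]_2 := a *: delta_mx 0 0 + b *: delta_mx 0 1.
have v0 : v 0 0 = a by rewrite !mxE /= mulr1 mulr0 addr0.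
have v1 : v 0 1 = b by rewrite !mxE /= mulr1 mulr0 add0r.
have vE : v = 0.
  apply: (imm u Uu); rewrite big_ord_recl big_ord1 ord2_1 v0 v1.
  exact: ab.
by rewrite -v0 -v1 vE !mxE.
Qed.

Let E u := met (pderive 0 X u) (pderive 0 X u).
Let F u := met (pderive 0 X u) (pderive 1 X u).
Let G u := met (pderive 1 X u) (pderive 1 X u).
Let D u := E u * G u - F u ^+ 2.
Let h1 i u := (pderive i X u).2.
Let Y i j u := pderive i (pderive j X) u.
Let h2 i j u := (Y i j u).2.
Let L u := G u * h2 0 0 u - F u * (h2 0 1 u + h2 1 0 u) + E u * h2 1 1 u.

Lemma first_form_pos u : U u -> 0 < E u /\ 0 < D u.
Proof. move=> Uu. exact (first_form_posdef hkappa (chart_frame Uu)). Qed.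

Lemma gradient_angle u : U u ->
  D u * (1 - nu u ^+ 2) = (G u * h1 0 u - F u * h1 1 u) * h1 0 u +
                          (E u * h1 1 u - F u * h1 0 u) * h1 1 u.
Proof. move=> Uu. exact (gradient_norm hkappa (chart_frame Uu)). Qed.

Let P k u := G u * met (Y 0 0 u) (pderive k X u)
  - F u * (met (Y 0 1 u) (pderive k X u) + met (Y 1 0 u) (pderive k X u))
  + E u * met (Y 1 1 u) (pderive k X u).

Lemma height_equation u : U u ->
  D u * L u = (G u * h1 0 u - F u * h1 1 u) * P 0 u + (E u * h1 1 u - F u * h1 0 u) * P 1 u
    + 2 * D u ^+ 2 * (nu u * H (nu u)).
Proof.
move=> Uu; have fr := chart_frame Uu.
apply: (height_hessian hkappa fr).
have mH : mean_curvature kappa X (eta (x u)) u = H (nu u).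
  by have [_ _ /(_ x Ax u Uu)] := hsurf.
rewrite -mH; exact: (mean_curvature_trace hkappa fr (erefl _) (erefl _)).
Qed.

(** At an extremum of the height the gradient vanishes, so the normal is vertical
    and the sign of the Hessian is that of [nu * H nu]; [tau] is [1] for a
    maximum and [-1] for a minimum. *)
Lemma extremum_sign (tau : R) u : U u -> tau ^+ 2 = 1 ->
  (\forall v \near u, tau * h v <= tau * h u) ->
  nu u ^+ 2 = 1 /\ tau * (nu u * H (nu u)) <= 0.
Proof.
move=> Uu tau1 hmax; have [E0 D0] := first_form_pos Uu.
have fL : functional (fun V : 'rV[R]_3 * R => tau * V.2).
  split; first by move=> k V W; rewrite /= mulrDr mulrCA.
  move=> V; apply: continuousM; [exact: cst_continuous|exact: (functional_height R).2].
have [pf pf1] := C2_functional chart_C2 fL.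
have [h10 h11 Lle] : [/\ tau * h1 0 u = 0, tau * h1 1 u = 0 &
    G u * (tau * h2 0 0 u) - F u * (tau * h2 0 1 u + tau * h2 1 0 u)
    + E u * (tau * h2 1 1 u) <= 0].
  exact: (interior_max (lp_open_dom (l := x)) Uu pf pf1 E0 D0 hmax).
have tau0 : tau != 0 by rewrite -sqrf_eq0 tau1 oner_eq0.
move/eqP: h10; rewrite mulf_eq0 (negPf tau0) /= => /eqP h10.
move/eqP: h11; rewrite mulf_eq0 (negPf tau0) /= => /eqP h11.
have {}Lle : tau * L u <= 0.
  by move: Lle; rewrite scale_operator.
move: (gradient_angle Uu) (height_equation Uu) Lle D0; rewrite h10 h11.
move: (E u) (F u) (G u) (P 0 u) (P 1 u) (L u) (D u) (nu u) (H (nu u)).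
move=> e f g p0 p1 l d n m grad eqn Lle D0.
have d_neq0 : d != 0 by rewrite gt_eqF.
split.
  move/eqP: grad; rewrite !mulr0 addr0 mulf_eq0 (negPf d_neq0) /= subr_eq0.
  by rewrite eq_sym => /eqP.
move: eqn; rewrite !mulr0 subr0 !mul0r !add0r => eqn.
have D20 : 0 < 2 * d by rewrite mulr_gt0.
rewrite -(pmulr_rle0 _ D20).
have -> : 2 * d * (tau * (n * m)) = tau * l; last by [].
by apply: (mulfI d_neq0); rewrite [RHS]mulrCA eqn; ring.
Qed.

Hypothesis hH : C1_on_segment H.

Definition bounded_at (u : 'rV[R]_2) (f : 'rV[R]_2 -> R) :=
  exists B, \forall v \near u, `|f v| <= B.

Lemma continuous_bounded u f : {for u, continuous f} -> bounded_at u f.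
Proof.
move=> /cvgrPdist_lt /(_ 1 ltr01) cf; exists (`|f u| + 1).
apply: filterS cf => v fv; rewrite -[f v](subrK (f u)) addrC.
by apply: le_trans (ler_normD _ _) _; rewrite lerD2l distrC ltW.
Qed.

Lemma bounded_add u f g : bounded_at u f -> bounded_at u g ->
  bounded_at u (fun v => `|f v| + `|g v|).
Proof.
move=> [B fB] [C gC]; exists (B + C); apply: filterS2 fB gC => v fB gC.
by rewrite ger0_norm ?addr_ge0 // lerD.
Qed.

(** The strong maximum principle applies to the height at an extremum where the
    angle is a zero [eps] of [H]: then [H (nu) = O(1 - nu^2)] near the point,
    hence [H (nu)] is controlled by the gradient of the height. *)
Lemma chart_constancy (tau eps : R) u : U u -> tau ^+ 2 = 1 -> eps ^+ 2 = 1 ->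
  H eps = 0 -> nu u = eps ->
  (\forall v \near u, tau * h v <= tau * h u) -> \forall v \near u, h v = h u.
Proof.
move=> Uu tau1 eps1 Heps nu_u hmax.
have tau0 : tau != 0 by rewrite -sqrf_eq0 tau1 oner_eq0.
have ntau : `|tau| = 1.
  by apply/eqP; rewrite -(@sqrp_eq1 _ `|tau|) // real_normK ?num_real // tau1.
have fL : functional (fun V : 'rV[R]_3 * R => tau * V.2).
  split; first by move=> k V W; rewrite /= mulrDr mulrCA.
  move=> V; apply: continuousM; [exact: cst_continuous|exact: (functional_height R).2].
have [pf pf1] := C2_functional chart_C2 fL.
have [cX C2] := chart_C2.
have cX1 i v : U v -> {for v, continuous (pderive i X)}.
  by move=> Uv; have [_ [cX1 _]] := C2 i; exact: cX1.
have cX2 i j v : U v -> {for v, continuous (Y i j)}.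
  by move=> Uv; have [_ [_ C1]] := C2 j; have [_ [cY _]] := C1 i; exact: cY.
have cE : {for u, continuous E} by apply: metric_continuous; exact: cX1.
have cF : {for u, continuous F} by apply: metric_continuous; exact: cX1.
have cG : {for u, continuous G} by apply: metric_continuous; exact: cX1.
have cD : {for u, continuous D}.
  exact: (continuousB (continuousM cE cG) (continuousM cF cF)).
have cYX i j k : {for u, continuous (fun v => met (Y i j v) (pderive k X v))}.
  by apply: metric_continuous; [exact: cX2|exact: cX1].
have cP k : {for u, continuous (P k)}.
  exact: (continuousD (continuousB (continuousM cG (cYX 0 0 k))
    (continuousM cF (continuousD (cYX 0 1 k) (cYX 1 0 k)))) (continuousM cE (cYX 1 1 k))).
have ch1 i : {for u, continuous (h1 i)}.
  by apply: continuous_comp; [exact: cX1|exact: (functional_height R).2].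
have cnu : {for u, continuous nu}.
  have [_ [ceta _] _] := hsurf.
  have cex : {for u, continuous (eta \o x)}.
    by apply: continuous_comp; [exact: lp_map_continuous|exact: ceta].
  by apply: metric_continuous; [exact: cex|exact: cst_continuous].
have [B HB] := bounded_add (bounded_add (bounded_add (continuous_bounded cE)
  (continuous_bounded cF)) (bounded_add (continuous_bounded cG) (continuous_bounded (cP 0))))
  (bounded_add (continuous_bounded (cP 1)) (bounded_add (continuous_bounded (ch1 0))
    (continuous_bounded (ch1 1)))).
have eps_seg : -1 <= eps <= 1.
  have : (eps - 1) * (eps + 1) = 0 by rewrite -subr_sqr eps1 expr1n subrr.
  by move/eqP; rewrite mulf_eq0 => /orP[/eqP e|/eqP e]; apply/andP; split; lra.
have [C C0 HC] := linear_bound_at_zero hH eps_seg Heps.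
have [E0 D0] := first_form_pos Uu.
pose lam := D u / 2.
have lam0 : 0 < lam by rewrite divr_gt0.
have nD : \forall v \near u, lam < D v.
  by have /cvgr_gt := cD; apply; rewrite /lam ltr_pdivrMr // ltr_pMr // ltr1n.
have nnu : \forall v \near u, 0 < eps * nu v.
  have c : {for u, continuous (fun v => eps * nu v)}.
    by apply: continuousM; [exact: cst_continuous|exact: cnu].
  by have /cvgr_gt := c; apply; rewrite nu_u -expr2 eps1.
have nC : \forall v \near u, -1 <= nu v <= 1 -> `|H (nu v)| <= C * `|nu v - eps|.
  have HC' : \forall y \near nu u, -1 <= y <= 1 -> `|H y| <= C * `|y - eps| by rewrite nu_u.
  exact: cnu HC'.
have nU := chart_open_nbhs Uu.
pose K := 2 * B ^+ 2 / lam + 4 * C * B ^+ 2.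
have K0 : 0 <= K.
  have B2 := sqr_ge0 B; apply: addr_ge0.
    by apply: divr_ge0; [exact: mulr_ge0|exact: ltW].
  by apply: mulr_ge0 => //; exact: mulr_ge0.
have cth v : U v -> {for v, continuous (fun v => tau * h v)}.
  move=> Uv; have c : {for v, continuous ((fun V : 'rV[R]_3 * R => tau * V.2) \o X)}.
    by apply: continuous_comp; [exact: cX|exact: fL.2].
  exact: c.
have S : \forall v \near u, tau * h v = tau * h u.
  apply: (@strong_maximum_principle R U lam B K u _ E F G
    (fun i v => tau * h1 i v) (fun i j v => tau * h2 i j v)
    (lp_open_dom (l := x)) Uu lam0 K0 cth pf pf1 _ hmax).
  near=> v.
  have Uv : U v by near: v.
  have vB : `| `| `| `|E v| + `|F v| | + `| `|G v| + `|P 0 v| | | +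
      `| `|P 1 v| + `| `|h1 0 v| + `|h1 1 v| | | | <= B by near: v; exact: HB.
  have vD : lam < D v by near: v; exact: nD.
  have vn : 0 < eps * nu v by near: v; exact: nnu.
  have vC : -1 <= nu v <= 1 -> `|H (nu v)| <= C * `|nu v - eps| by near: v; exact: nC.
  have [Ev0 Dv0] := first_form_pos Uv.
  have n1 : nu v ^+ 2 <= 1 by exact: (angle_le1 hkappa (chart_frame Uv)).
  move: (gradient_angle Uv) (height_equation Uv) vC vB Ev0 vD; rewrite scale_operator.
  rewrite -/(L v) -/(D v); move: n1 vn.
  move: (E v) (F v) (G v) (P 0 v) (P 1 v) (L v) (D v) (nu v) (H (nu v)) (h1 0 v) (h1 1 v).
  move=> e f g p0 p1 l d n m a b n1 vn grad eqn vC vB Ev0 vD.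
  have nn1 : `|n| <= 1 by rewrite -(@ler_pXn2r _ 2) ?nnegrE // expr1n real_normK ?num_real.
  have m1 : `|m| <= C * (1 - n ^+ 2).
    have {}vC : `|m| <= C * `|n - eps| by apply: vC; rewrite -ler_norml.
    by apply: le_trans vC _; rewrite ler_wpM2l // angle_defect.
  move: vB; rewrite ger0_norm; last by do !apply: addr_ge0.
  rewrite !(ger0_norm (addr_ge0 _ _)) ?addr_ge0 // => vB.
  have [[eB fB gB] [p0B p1B aB bB]] := sum_bounds vB.
  split=> //; [exact: ltW|exact: le_trans (ler_norm _) eB|exact: le_trans (ler_norm _) gB|].
  have est : `|l| <= K * (`|a| + `|b|).
    exact: (height_estimate eB fB gB p0B p1B aB bB lam0 (ltW vD) C0 nn1 grad eqn m1).
  rewrite !normrM ntau !mul1r mulNr lerNl.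
  by apply: le_trans est; rewrite -mulrN -[`|l|]mul1r -ntau -normrM -normrN -mulrN; exact: ler_norm.
by apply: filterS S => v /(mulfI tau0).
Unshelve. all: by end_near. Qed.

End OneChart.

Hypothesis hclosed : closed_connected_surface A.
Hypothesis hH : C1_on_segment H.

Lemma chart_cover p : exists2 x, A x & exists2 u, lp_dom x u & x u = p.
Proof.
have [_ _ _ _ [cov _]] := hclosed.
by have [x Ax [u Uu xu]] := cov p; exists x => //; exists u.
Qed.

Lemma psi_continuous : continuous psi.
Proof.
move=> p; have [x Ax [u Uu <-]] := chart_cover p.
apply: (continuous_chart Uu).
by have [cX _] := chart_C2 Ax; exact: cX.
Qed.

Lemma height_continuous : continuous (fun p => (psi p).2).
Proof.
move=> p; apply: (@continuous_comp _ _ _ psi); first exact: psi_continuous.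
exact: (functional_height R).2.
Qed.

Lemma angle_continuous : continuous (angle kappa eta).
Proof.
move=> p; have [_ [ceta _] _] := hsurf.
by apply: metric_continuous; [exact: ceta|exact: cst_continuous].
Qed.

Lemma function_max (f : T -> R) : continuous f -> exists p, forall q, f q <= f p.
Proof.
move=> cf; have [T0 _ cT _ _] := hclosed.
have [c _ cmax] := compact_EVT_max T0 cT (continuous_subspaceT cf).
by exists c => q; apply: cmax; rewrite inE.
Qed.

Lemma clopen_full (S : set T) p : S p -> (forall q, S q -> \forall r \near q, S r) ->
  closed S -> forall q, S q.
Proof.
move=> Sp oS cS q; have [_ _ _ conT _] := hclosed.
have -> : S = [set: T]; last by [].
apply: conT; first by exists p.
  by exists S; [rewrite openE => r; exact: oS|rewrite setTI].
by exists S; [exact: cS|rewrite setTI].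
Qed.

Lemma height_extremum (tau : R) : tau ^+ 2 = 1 -> exists2 p,
  forall q, tau * (psi q).2 <= tau * (psi p).2 &
  exists eps, [/\ angle kappa eta p = eps, eps ^+ 2 = 1 & tau * (eps * H eps) <= 0].
Proof.
move=> tau1.
have c : continuous (fun p => tau * (psi p).2).
  move=> p; apply: (@continuous_comp _ _ _ (fun p => (psi p).2) ( *%R tau)).
    exact: height_continuous.
  exact: mulrl_continuous.
have [p pmax] := function_max c; exists p => //.
have [x Ax [u Uu xu]] := chart_cover p; exists (angle kappa eta p).
have umax : \forall v \near u, tau * (psi (x v)).2 <= tau * (psi (x u)).2.
  by apply: (@filterE _ _ (nbhs_filter u)) => v; rewrite xu; exact: pmax.
by rewrite -xu; have [? ?] := extremum_sign Ax Uu tau1 umax; split.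
Qed.

(** The points at the extremal height with angle [eps] form a closed set; it is
    open by [chart_constancy], because the angle is continuous and equal to [1]
    or [-1] at every point of extremal height. *)
Lemma height_constant (tau eps : R) p : tau ^+ 2 = 1 -> eps ^+ 2 = 1 -> H eps = 0 ->
  (forall q, tau * (psi q).2 <= tau * (psi p).2) -> angle kappa eta p = eps ->
  forall q, (psi q).2 = (psi p).2.
Proof.
move=> tau1 eps1 Heps pmax ap q.
pose S := [set q | (psi q).2 = (psi p).2] `&` [set q | angle kappa eta q = eps].
suff [] : S q by [].
apply: (@clopen_full S p); first by split.
  move=> r [/= hr ar]; have [x Ax [u Uu xu]] := chart_cover r.
  rewrite -xu; apply/(near_chart S Uu).
  have umax : \forall v \near u, tau * (psi (x v)).2 <= tau * (psi (x u)).2.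
    by apply: (@filterE _ _ (nbhs_filter u)) => v; rewrite xu hr; exact: pmax.
  have au : angle kappa eta (x u) = eps by rewrite xu.
  have hcst := chart_constancy Ax hH Uu tau1 eps1 Heps au umax.
  have cang : {for u, continuous (fun v => eps * angle kappa eta (x v))}.
    apply: continuousM; first exact: cst_continuous.
    apply: (@continuous_comp _ _ _ x); first exact: lp_map_continuous.
    exact: angle_continuous.
  have apos : \forall v \near u, 0 < eps * angle kappa eta (x v).
    by have /cvgr_gt := cang; apply; rewrite au -expr2 eps1.
  have nU := chart_open_nbhs Uu.
  near=> v; have Uv : lp_dom x v by near: v.
  have hv : (psi (x v)).2 = (psi (x u)).2 by near: v.
  have av : 0 < eps * angle kappa eta (x v) by near: v.
  split; first by rewrite /= hv xu.
  have vmax : \forall w \near v, tau * (psi (x w)).2 <= tau * (psi (x v)).2.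
    by apply: (@filterE _ _ (nbhs_filter v)) => w; rewrite hv xu hr; exact: pmax.
  have [nu1 _] := extremum_sign Ax Uv tau1 vmax.
  move: nu1 av eps1 => /=; set n := angle kappa eta (x v) => nu1 av eps1.
  have : (n - eps) * (n + eps) = 0 by rewrite -subr_sqr nu1 eps1 subrr.
  move/eqP; rewrite mulf_eq0 => /orP[|]; first by rewrite subr_eq0 => /eqP.
  by rewrite addr_eq0 => /eqP nE; move: av; rewrite nE mulrN -expr2 eps1; lra.
apply: closedI.
  have -> : [set q | (psi q).2 = (psi p).2] = (fun q => (psi q).2) @^-1` [set (psi p).2] by [].
  by apply: closed_comp; [move=> r _; exact: height_continuous|exact: closed_eq].
have -> : [set q | angle kappa eta q = eps] = (angle kappa eta) @^-1` [set eps] by [].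
by apply: closed_comp; [move=> r _; exact: angle_continuous|exact: closed_eq].
Unshelve. all: by end_near. Qed.

(** With the signs [e1] and [e2] of the angle at a highest and a lowest point,
    [e1 * H e1 <= 0 <= e2 * H e2].  If neither value vanishes, then [e1 <> e2]
    and these inequalities say that [H 1] and [H (-1)] have the same strict
    sign. *)
Lemma horizontal_or_positive : 0 < H (-1) * H 1 \/
  (H (-1) * H 1 = 0 /\ exists t0, forall q, (psi q).2 = t0).
Proof.
have [pos|npos] := ltrP 0 (H (-1) * H 1); [by left|right].
have flat_of (tau eps : R) p : tau ^+ 2 = 1 -> eps ^+ 2 = 1 -> H eps = 0 ->
    (forall q, tau * (psi q).2 <= tau * (psi p).2) -> angle kappa eta p = eps ->
    H (-1) * H 1 = 0 /\ exists t0, forall q, (psi q).2 = t0.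
  move=> tau1 eps1 Heps pmax ap; split; last first.
    by exists (psi p).2; exact: height_constant Heps pmax ap.
  have : (eps - 1) * (eps + 1) = 0 by rewrite -subr_sqr eps1 expr1n subrr.
  move/eqP; rewrite mulf_eq0 subr_eq0 addr_eq0 => /orP[/eqP e|/eqP e].
    by move: Heps; rewrite e => ->; rewrite mulr0.
  by move: Heps; rewrite e => ->; rewrite mul0r.
have one2 : (1 : R) ^+ 2 = 1 by rewrite expr1n.
have mone2 : (-1 : R) ^+ 2 = 1 by rewrite sqrrN.
have [p pmax [e1 [ap e11 He1]]] := height_extremum one2.
have [p' pmin [e2 [ap' e21 He2]]] := height_extremum mone2.
have sgn (e : R) : e ^+ 2 = 1 -> e = 1 \/ e = -1.
  move=> ee; have : (e - 1) * (e + 1) = 0 by rewrite -subr_sqr ee expr1n subrr.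
  by move/eqP; rewrite mulf_eq0 subr_eq0 addr_eq0 => /orP[/eqP e0|/eqP e0]; [left|right].
have [He0|He0] := pselect (H e1 = 0); first exact: flat_of He0 pmax ap.
have [He0'|He0'] := pselect (H e2 = 0); first exact: flat_of He0' pmin ap'.
exfalso; case: (sgn _ e11) => E1; case: (sgn _ e21) => E2;
  rewrite ?E1 ?E2 in He1 He2 He0 He0'.
- by apply: He0; lra.
- have a : H 1 < 0 by rewrite lt_neqAle; apply/andP; split; [exact/eqP|lra].
  have b : H (-1) < 0 by rewrite lt_neqAle; apply/andP; split; [exact/eqP|lra].
  by have := nmulr_rgt0 (H 1) b; rewrite a; lra.
- have a : 0 < H (-1) by rewrite lt_neqAle eq_sym; apply/andP; split; [exact/eqP|lra].
  have b : 0 < H 1 by rewrite lt_neqAle eq_sym; apply/andP; split; [exact/eqP|lra].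
  by have := mulr_gt0 a b; lra.
- by apply: He0; lra.
Qed.

End Height.

(** * Local homeomorphisms from a compact space to the sphere *)

Definition locally_injective (T U : topologicalType) (f : T -> U) :=
  forall p : T, exists2 W : set T, nbhs p W &
  forall q q', W q -> W q' -> f q = f q' -> q = q'.

(** Openness as a map to [M], phrased with balls of the ambient space so that [M]
    need not be turned into a type. *)
Definition locally_open_onto (R : realType) (T : topologicalType) (V : normedModType R)
    (M : set V) (f : T -> V) :=
  forall (p : T) (W : set T), nbhs p W -> exists2 r : R, 0 < r &
  forall y, M y -> ball (f p) r y -> exists2 q, W q & f q = y.

Section Sheets.
Variables (R : realType) (T : topologicalType) (V : normedModType R).
Variables (M : set V) (f : T -> V).
Hypothesis T_hausdorff : hausdorff_space T.
Hypothesis T_compact : compact [set: T].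
Hypothesis f_continuous : continuous f.
Hypothesis f_loc_inj : locally_injective f.
Hypothesis f_loc_open : locally_open_onto M f.

(** [E (p, q)] says that [q] is so close to [p] that it is determined by [f q].
    This replaces a uniform structure on [T] that would make local injectivity
    uniform. *)
Definition sheet_relation (E : set (T * T)) :=
  [/\ open E, forall p, E (p, p) &
      forall p q q', E (p, q) -> E (p, q') -> f q = f q' -> q = q'].

(** The neighbourhoods of the diagonal, ordered by inclusion, form a filter; by
    compactness it is enough to find, near each [p], one of them that confines
    the points related to a point near [p] to an open set where [f] is
    injective. *)
Lemma sheet_relation_exists : exists E, sheet_relation E.
Proof.
pose diag := [set E : set (T * T) | forall r : T, nbhs (r, r) E].
pose F : set_system (set (T * T)) := filter_from diag (fun E0 => [set E | E `<=` E0]).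
have FF : Filter F.
  apply: filter_from_filter; first by exists setT => r; exact: filterT.
  move=> E0 E1 d0 d1; exists (E0 `&` E1); first by move=> r; apply: filterI; [exact: d0|exact: d1].
  by move=> E EE; split=> z /EE [].
pose P (E : set (T * T)) p := forall q q', E (p, q) -> E (p, q') -> f q = f q' -> q = q'.
have /compact_near_coveringP /(_ _ F P FF) nc := T_compact.
have [E0 dE0 HE0] : \near F, [set: T] `<=` P F.
  apply: nc => p _.
  have [W Wp injW] := f_loc_inj p.
  have Wo : nbhs p W° by exact: nbhs_interior.
  have Tp : nbhs p [set: T] by exact: filterT.
  have [U Up clU] := compact_regular T_hausdorff T_compact Tp Wo.
  pose E1 : set (T * T) := [set z | closure U z.1 -> W° z.2].
  exists (U, [set E | E `<=` E1]); last first.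
    move=> [p' E] /= [Up' EE1] q q' /EE1 /= Eq /EE1 /= Eq'.
    have clp' : closure U p' by exact: subset_closure.
    by apply: injW; apply: interior_subset; [exact: Eq|exact: Eq'].
  split=> //=; exists E1 => // r.
  have [clr|clr] := pselect (closure U r).
    have Wr : nbhs r W° by apply: open_nbhs_nbhs; split; [exact: open_interior|exact: clU].
    have : nbhs (r, r) (snd @^-1` W°) by exact: cvg_snd.
    by apply: filterS => z /= Wz _.
  have oC : nbhs r (~` closure U).
    by apply: open_nbhs_nbhs; split=> //; rewrite openC; exact: closed_closure.
  have : nbhs (r, r) (fst @^-1` (~` closure U)) by exact: cvg_fst.
  by apply: filterS => z /= nz /nz.
exists E0°; split; first exact: open_interior.
  by move=> p; exact: dE0.
by move=> p; apply: (HE0 E0°) => //; exact: interior_subset.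
Qed.

Variable E : set (T * T).
Hypothesis hE : sheet_relation E.

(** Compactness makes the radius of the balls covered by the sheets uniform. *)
Lemma sheet_radius : exists2 eps : R, 0 < eps & forall p y, M y -> ball (f p) eps y ->
  exists2 q, E (p, q) & f q = y.
Proof.
have [oE dE _] := hE.
pose P (eps : R) p := forall y, M y -> ball (f p) eps y -> exists2 q, E (p, q) & f q = y.
have /compact_near_coveringP /(_ _ (0^'+) P _) nc := T_compact.
have H : \forall eps \near (0 : R)^'+, [set: T] `<=` P eps.
  apply: nc => p _.
  have /= [[A B] /= [Ap Bp] AB] : nbhs (p, p) E by apply: open_nbhs_nbhs; split.
  have [r r0 Hr] := f_loc_open Bp.
  have r20 : 0 < r / 2 by rewrite divr_gt0.
  have fp : \forall p' \near p, ball (f p) (r / 2) (f p').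
    by apply: f_continuous; exact: nbhsx_ballx.
  exists (A `&` [set p' | ball (f p) (r / 2) (f p')], [set e | e < r / 2]).
    by split; [exact: filterI|exact: nbhs_right_lt].
  move=> [p' e] /= [[Ap' fp'] er] y My yb.
  have [|q Bq fq] := Hr y My.
    rewrite [r](splitr r); apply: ball_triangle fp' _.
    by apply: le_ball yb; exact: ltW.
  by exists q => //; apply: AB.
have Hpos : \forall eps \near (0 : R)^'+, 0 < eps by exact: nbhs_right_gt.
near (0 : R)^'+ => eps.
have He : [set: T] `<=` P eps by near: eps; exact: H.
exists eps; first by near: eps; exact: Hpos.
by move=> p; exact: He.
Unshelve. all: by end_near. Qed.

(** The point above [y] in the sheet through [p]; [p] itself is a default value
    when there is none. *)
Definition slide (p : T) (y : V) : T :=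
  xget p [set q | E (p, q) /\ f q = y].

Lemma slideE p q : E (p, q) -> slide p (f q) = q.
Proof.
have [_ _ uE] := hE.
move=> Epq; rewrite /slide; case: xgetP => [q' _ [Epq' fq']|/(_ q) []//].
exact: (uE p).
Qed.

(** A lift [s] of a map can be modified into a lift of any map [g] that is
    uniformly close to it. *)
Lemma slide_continuous (Y : topologicalType) (s : Y -> T) (g : Y -> V) (eps : R) :
  (forall p y, M y -> ball (f p) eps y -> exists2 q, E (p, q) & f q = y) ->
  continuous s -> continuous g -> (forall y, M (g y)) ->
  (forall y, ball (f (s y)) eps (g y)) ->
  continuous (fun y => slide (s y) (g y)) /\
  forall y, f (slide (s y) (g y)) = g y.
Proof.
move=> Heps cs cg Mg near_g.
have [oE _ _] := hE.
have ex y : exists2 q, E (s y, q) & f q = g y by exact: Heps.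
split; last by move=> y; have [q Eq <-] := ex y; rewrite slideE.
move=> y0 /= W Wq.
have [q Eq fq] := ex y0; move: Wq; rewrite -fq slideE // => Wq.
have /= [[A B] /= [Ap Bq] AB] : nbhs (s y0, q) E by apply: open_nbhs_nbhs; split.
have [r r0 Hr] := f_loc_open (filterI Wq Bq).
have n1 : \forall y \near y0, A (s y) by exact: cs.
have n2 : \forall y \near y0, ball (f q) r (g y).
  by rewrite fq; apply: cg; exact: nbhsx_ballx.
apply: filterS2 n1 n2 => y Asy gy.
have [q' [Wq' Bq'] fq'] := Hr _ (Mg y) gy.
by rewrite /= -fq' slideE //; exact: AB.
Qed.

End Sheets.

Section CompactSection.
Variables (R : realType) (T : topologicalType) (V : normedModType R).
Variables (f : T -> V).
Hypothesis T_hausdorff : hausdorff_space T.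
Hypothesis T_connected : connected [set: T].
Hypothesis f_continuous : continuous f.
Hypothesis f_loc_inj : locally_injective f.

(** The image of [s] is closed, and it is open because points near [s y0] have
    the same [f]-value as some point of [Q] that [s] must send near [s y0]. *)
Lemma compact_section (Y : topologicalType) (Q : set Y) (s : Y -> T) :
  Q !=set0 -> compact Q -> continuous s ->
  (forall y y', Q y -> Q y' -> f (s y) = f (s y') -> s y = s y') ->
  (forall p, exists2 y, Q y & f (s y) = f p) ->
  (forall p, exists2 y, Q y & s y = p) /\ injective f.
Proof.
move=> [y00 Qy00] cQ cs fib surj.
suff sQ : s @` Q = [set: T].
  have im p : exists2 y, Q y & s y = p by have : [set: T] p by []; rewrite -sQ.
  split=> // p p'; have [y Qy <-] := im p; have [y' Qy' <-] := im p'.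
  exact: fib.
apply: T_connected.
- by exists (s y00), y00.
- exists (s @` Q); last by rewrite setTI.
  rewrite openE => _ [y0 Qy0 <-].
  have [W Wq injW] := f_loc_inj (s y0).
  have Wo : nbhs (s y0) W° by exact: nbhs_interior.
  pose bad := Q `&` s @^-1` (~` W°).
  have cbad : compact bad.
    apply: compact_closedI => //.
    by apply: closed_comp; [move=> y _; exact: cs|rewrite closedC; exact: open_interior].
  have cfs : continuous (f \o s).
    by move=> y; apply: continuous_comp; [exact: cs|exact: f_continuous].
  have clim : closed ((f \o s) @` bad).
    apply: compact_closed; first exact: norm_hausdorff.
    by apply: continuous_compact => //; exact: continuous_subspaceT.
  have nim : ~ ((f \o s) @` bad) (f (s y0)).
    move=> [y [Qy Wy]] /= e; apply: Wy.
    by rewrite (fib y y0) //; exact: nbhs_singleton.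
  have nO : \forall p \near s y0, ~ ((f \o s) @` bad) (f p).
    have nb : nbhs (f (s y0)) (~` ((f \o s) @` bad)).
      by apply: open_nbhs_nbhs; split=> //; rewrite openC.
    exact: f_continuous nb.
  apply: filterS2 Wq nO => p Wp np.
  have [y Qy fy] := surj p; exists y => //.
  apply: injW => //; apply: interior_subset.
  have [//|nW] := pselect (W° (s y)).
  by exfalso; apply: np; exists y => //; split.
exists (s @` Q); last by rewrite setTI.
apply: compact_closed => //.
by apply: continuous_compact => //; exact: continuous_subspaceT.
Qed.

End CompactSection.

Section SphereCovering.
Variables (R : realType) (T : topologicalType).
Local Notation space3 := 'rV[R]_3.
Implicit Types (y : space3) (a b c x phi : R).

Definition sphere : set space3 := [set y | form3 1 y y = 1].

Definition vec3 a b c : space3 := \row_(k < 3) nth 0 [:: a; b; c] k.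

Lemma vec3E a b c : [/\ vec3 a b c 0 (inord 0) = a, vec3 a b c 0 (inord 1) = b
  & vec3 a b c 0 (inord 2) = c].
Proof. by rewrite !mxE !inordK. Qed.

Lemma rV3_eq (y z : space3) : y 0 (inord 0) = z 0 (inord 0) -> y 0 (inord 1) = z 0 (inord 1) ->
  y 0 (inord 2) = z 0 (inord 2) -> y = z.
Proof.
move=> e0 e1 e2; apply/eqP; rewrite -subr_eq0; apply/eqP.
by apply: rV3_eq0; rewrite !mxE ?e0 ?e1 ?e2 subrr.
Qed.

Lemma rV3_ball (y z : space3) (r : R) : 0 < r -> `|y 0 (inord 0) - z 0 (inord 0)| < r ->
  `|y 0 (inord 1) - z 0 (inord 1)| < r -> `|y 0 (inord 2) - z 0 (inord 2)| < r -> ball y r z.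
Proof.
move=> r0 h0 h1 h2; split=> // i j; rewrite /ball /=.
have -> : i = 0 by apply/val_inj; case: i => [[]].
by rewrite -(inord_val j); case: j => [[|[|[|j]]] j3].
Qed.

Lemma vec3_continuous (Y : topologicalType) (a b c : Y -> R) :
  continuous a -> continuous b -> continuous c ->
  continuous (fun z => vec3 (a z) (b z) (c z)).
Proof.
move=> ca cb cc z; apply/cvgrPdist_lt => e e0.
have /cvgrPdist_lt /(_ e e0) na := ca z.
have /cvgrPdist_lt /(_ e e0) nb := cb z.
have /cvgrPdist_lt /(_ e e0) nc := cc z.
near=> w.
have : ball (vec3 (a z) (b z) (c z)) e (vec3 (a w) (b w) (c w)).
  have [za zb zc] := vec3E (a z) (b z) (c z); have [wa wb wc] := vec3E (a w) (b w) (c w).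
  apply: rV3_ball => //.
  - by rewrite za wa; near: w.
  - by rewrite zb wb; near: w.
  - by rewrite zc wc; near: w.
by rewrite -ball_normE.
Unshelve. all: by end_near. Qed.

Lemma abs_sub_le_of_derivative (f g : R -> R) :
  (forall x : R, is_derive x (1 : R) f (g x)) -> (forall x : R, `|g x| <= 1) ->
  forall x y : R, `|f x - f y| <= `|x - y|.
Proof.
move=> df g1 x y; wlog xy : x y / y <= x.
  by move=> W; have [/W//|/ltW/W] := leP y x; rewrite distrC [`|y - x|]distrC.
have df' z : z \in `]y, x[%R -> is_derive z (1 : R) f (g z) by move=> _; exact: df.
have cf : {within `[y, x], continuous f}.
  by apply: derivable_within_continuous => z _; case: (df z).
have [z _ ->] := MVT_segment xy df' cf.
by rewrite normrM ler_piMl.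
Qed.

Lemma sin_lipschitz x x' : `|sin x - sin x'| <= `|x - x'|.
Proof.
apply: (abs_sub_le_of_derivative (g := cos)) => t.
by rewrite ler_norml cos_geN1 cos_le1.
Qed.

Lemma cos_lipschitz x x' : `|cos x - cos x'| <= `|x - x'|.
Proof.
apply: (abs_sub_le_of_derivative (g := fun t => - sin t)) => t.
by rewrite normrN ler_norml sin_geN1 sin_le1.
Qed.

(** The point of colatitude [phi] on the meridian through [(a, b)]. *)
Definition meridian a b phi := vec3 (a * sin phi) (b * sin phi) (cos phi).

Lemma meridian_sphere a b phi : a ^+ 2 + b ^+ 2 = 1 -> sphere (meridian a b phi).
Proof.
move=> ab; have [e0 e1 e2] := vec3E (a * sin phi) (b * sin phi) (cos phi).
rewrite /sphere /= /form3 /meridian e0 e1 e2.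
have -> : a * sin phi * (a * sin phi) + b * sin phi * (b * sin phi) + 1 * (cos phi * cos phi)
  = (a ^+ 2 + b ^+ 2) * sin phi ^+ 2 + cos phi ^+ 2 by ring.
by rewrite ab mul1r addrC cos2Dsin2.
Qed.

Lemma meridian_close a b phi phi' (r : R) : `|a| <= 1 -> `|b| <= 1 -> `|phi - phi'| < r ->
  ball (meridian a b phi) r (meridian a b phi').
Proof.
move=> a1 b1 pr; have r0 : 0 < r by apply: le_lt_trans pr.
have [e0 e1 e2] := vec3E (a * sin phi) (b * sin phi) (cos phi).
have [e0' e1' e2'] := vec3E (a * sin phi') (b * sin phi') (cos phi').
have H k : `|k| <= 1 -> `|k * sin phi - k * sin phi'| < r.
  move=> k1; rewrite -mulrBr normrM; apply: le_lt_trans pr.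
  by apply: le_trans (sin_lipschitz _ _); rewrite ler_piMl.
apply: rV3_ball => //; rewrite /meridian.
- by rewrite e0 e0'; exact: H.
- by rewrite e1 e1'; exact: H.
by rewrite e2 e2'; apply: le_lt_trans pr; exact: cos_lipschitz.
Qed.

Lemma circle_angle a b : a ^+ 2 + b ^+ 2 = 1 ->
  exists2 t : R, - pi <= t <= pi & a = cos t /\ b = sin t.
Proof.
move=> ab.
have a1 : -1 <= a <= 1.
  rewrite -ler_norml -(@ler_pXn2r _ 2) ?nnegrE // expr1n real_normK ?num_real //.
  by have := sqr_ge0 b; lra.
have ai : a \in `[-1, 1]%R by rewrite in_itv.
have s : sin (acos a) = `|b|.
  by rewrite sin_acos // (_ : 1 - a ^+ 2 = b ^+ 2) ?sqrtr_sqr //; lra.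
have p0 := acos_ge0 a1; have p1 := acos_lepi a1; have pi0 := pi_gt0 R.
have [b0|b0] := lerP 0 b.
  exists (acos a); first by apply/andP; split; lra.
  by rewrite acosK // s ger0_norm.
exists (- acos a); first by apply/andP; split; lra.
by rewrite cosN sinN acosK // s ltr0_norm // opprK.
Qed.

Lemma meridian_surjective y : sphere y -> exists t phi : R,
  [/\ - pi <= t <= pi, 0 <= phi <= pi & meridian (cos t) (sin t) phi = y].
Proof.
rewrite /sphere /= /form3 mul1r.
set y0 := y 0 (inord 0); set y1 := y 0 (inord 1); set y2 := y 0 (inord 2) => yy.
have y21 : -1 <= y2 <= 1.
  rewrite -ler_norml -(@ler_pXn2r _ 2) ?nnegrE // expr1n real_normK ?num_real //.
  by have := sqr_ge0 y0; have := sqr_ge0 y1; rewrite !expr2; lra.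
have yi : y2 \in `[-1, 1]%R by rewrite in_itv.
pose phi := acos y2.
have phi01 : 0 <= phi <= pi by rewrite acos_ge0 ?acos_lepi.
have cphi : cos phi = y2 by exact: acosK.
have s2 : sin phi ^+ 2 = y0 ^+ 2 + y1 ^+ 2.
  have := cos2Dsin2 phi; rewrite cphi !expr2; lra.
have fin (a b : R) : a ^+ 2 + b ^+ 2 = 1 -> a * sin phi = y0 -> b * sin phi = y1 ->
  exists t phi : R, [/\ - pi <= t <= pi, 0 <= phi <= pi & meridian (cos t) (sin t) phi = y].
  move=> ab ay by1; have [t tpi [at_ bt]] := circle_angle ab.
  exists t, phi; split=> //; rewrite -at_ -bt.
  have [e0 e1 e2] := vec3E (a * sin phi) (b * sin phi) (cos phi).
  by apply: rV3_eq; rewrite /meridian ?e0 ?e1 ?e2.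
have [s0|s0] := eqVneq (sin phi) 0.
  move: s2; rewrite s0 expr0n /= => s2.
  have a0 := sqr_ge0 y0; have b0 := sqr_ge0 y1.
  have y00 : y0 = 0 by apply/eqP; rewrite -sqrf_eq0; apply/eqP; lra.
  have y10 : y1 = 0 by apply/eqP; rewrite -sqrf_eq0; apply/eqP; lra.
  by apply: (fin 1 0); rewrite ?s0 ?mulr0 ?y00 ?y10 // expr1n expr0n addr0.
apply: (fin (y0 / sin phi) (y1 / sin phi)); rewrite ?divfK //.
by rewrite !expr_div_n -mulrDl -s2 divff // expf_neq0.
Qed.

Variable f : T -> space3.
Hypothesis T_hausdorff : hausdorff_space T.
Hypothesis T_compact : compact [set: T].
Hypothesis T_connected : connected [set: T].
Hypothesis f_continuous : continuous f.
Hypothesis f_sphere : forall p, sphere (f p).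
Hypothesis f_loc_inj : locally_injective f.
Hypothesis f_loc_open : locally_open_onto sphere f.
Variable p0 : T.
Hypothesis fp0 : f p0 = vec3 0 0 1.

Section Lift.
Variable E : set (T * T).
Hypothesis hE : sheet_relation f E.
Variable eps : R.
Hypothesis eps0 : 0 < eps.
Hypothesis Heps : forall p y, sphere y -> ball (f p) eps y ->
  exists2 q, E (p, q) & f q = y.
Variable n : nat.
Hypothesis n_large : pi < eps * n.+1%:R :> R.

(** The meridian through [(a, b)] is lifted from the pole to colatitude [phi] in
    [n.+1] steps, each along one sheet. *)
Fixpoint lift (k : nat) (a b phi : R) : T :=
  if k is k'.+1 then slide f E (lift k' a b phi) (meridian a b (k'.+1%:R / n.+1%:R * phi))
  else p0.

Lemma north a b : meridian a b 0 = f p0.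
Proof. by rewrite fp0 /meridian sin0 cos0 !mulr0. Qed.

Lemma lift0 k a b : lift k a b 0 = p0.
Proof.
by elim: k => //= k ->; rewrite mulr0 north (slideE hE) //; case: hE.
Qed.

Let ca (z : R * R) : R := cos z.1.
Let sa (z : R * R) : R := sin z.1.
Let ph (z : R * R) : R := pi * sin z.2.

Lemma lift_correct k :
  continuous (fun z => lift k (ca z) (sa z) (ph z)) /\
  forall z, f (lift k (ca z) (sa z) (ph z)) = meridian (ca z) (sa z) (k%:R / n.+1%:R * ph z).
Proof.
have cca : continuous ca.
  by move=> z; apply: continuous_comp; [exact: cvg_fst|exact: continuous_cos].
have csa : continuous sa.
  by move=> z; apply: continuous_comp; [exact: cvg_fst|exact: continuous_sin].
have cph : continuous ph.
  move=> z; apply: (@continuous_comp _ _ _ (fun z : R * R => sin z.2) ( *%R pi)).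
    by apply: continuous_comp; [exact: cvg_snd|exact: continuous_sin].
  exact: mulrl_continuous.
elim: k => [|k [cl fl]] /=.
  by split; [exact: cst_continuous|move=> z; rewrite !mul0r north].
pose g (z : R * R) := meridian (ca z) (sa z) (k.+1%:R / n.+1%:R * ph z).
have cphk : continuous (fun z => k.+1%:R / n.+1%:R * ph z).
  move=> z; apply: (@continuous_comp _ _ _ ph ( *%R _)); first exact: cph.
  exact: mulrl_continuous.
have csin : continuous (fun z => sin (k.+1%:R / n.+1%:R * ph z)).
  by move=> z; apply: continuous_comp; [exact: cphk|exact: continuous_sin].
have cg : continuous g.
  apply: vec3_continuous.
  - by move=> z; apply: continuousM; [exact: cca|exact: csin].
  - by move=> z; apply: continuousM; [exact: csa|exact: csin].
  - by move=> z; apply: continuous_comp; [exact: cphk|exact: continuous_cos].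
have Mg z : sphere (g z) by apply: meridian_sphere; exact: cos2Dsin2.
have near_g z : ball (f (lift k (ca z) (sa z) (ph z))) eps (g z).
  rewrite fl; apply: meridian_close.
  - by rewrite ler_norml cos_geN1 cos_le1.
  - by rewrite ler_norml sin_geN1 sin_le1.
  have n0 : (0 : R) < n.+1%:R by rewrite ltr0n.
  rewrite -mulrBl -mulrBl -natr1 opprD addrA subrr sub0r mulN1r mulNr normrN normrM.
  rewrite gtr0_norm ?invr_gt0 // mulrC ltr_pdivrMr //; apply: le_lt_trans n_large.
  rewrite normrM (gtr0_norm (pi_gt0 R)) ler_piMr ?pi_ge0 //.
  by rewrite ler_norml sin_geN1 sin_le1.
exact (slide_continuous f_loc_open hE Heps cl cg Mg near_g).
Qed.

Let s (z : R * R) := lift n.+1 (ca z) (sa z) (ph z).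

Lemma s_continuous : continuous s.
Proof. by have [] := lift_correct n.+1. Qed.

Lemma f_s z : f (s z) = meridian (ca z) (sa z) (ph z).
Proof. by have [_ ->] := lift_correct n.+1; rewrite divff ?mul1r // pnatr_eq0. Qed.

(** The lifts of all meridians end above the south pole, in a discrete fibre;
    depending continuously on the longitude, the end point is constant. *)
Lemma s_south t t' : s (t, pi / 2) = s (t', pi / 2).
Proof.
pose g x := s (x, pi / 2).
have cg : continuous g.
  move=> x; apply: (@continuous_comp _ _ _ (fun x => (x, pi / 2)) s).
    exact: (cvg_pair cvg_id (cvg_cst _)).
  exact: s_continuous.
have fg x : f (g x) = meridian 0 0 pi.
  by rewrite f_s /ph /= sin_pihalf mulr1 /meridian sinpi !mulr0.
have gloc x : \forall x' \near x, g x' = g x.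
  have [W Wx injW] := f_loc_inj (g x).
  have : \forall x' \near x, W (g x') by exact: cg.
  by apply: filterS => x' Wx'; apply: injW => //; [exact: nbhs_singleton|rewrite !fg].
suff E' : [set x | g x = g t] = [set: R].
  by symmetry; have : [set: R] t' by []; rewrite -E'.
have cR : connected [set: R] by apply/connected_intervalP.
apply: cR; first by exists t.
  exists [set x | g x = g t]; last by rewrite setTI.
  by rewrite openE => x /= gx; apply: filterS (gloc x) => x' /= ->.
exists [set x | g x = g t]; last by rewrite setTI.
rewrite -openC openE => x /= gx; apply: filterS (gloc x) => x' /= ->.
exact: gx.
Qed.

(** A point of the sphere other than the poles determines its meridian and its
    colatitude; at the north pole all lifts start from [p0], and at the south
    pole they end at the same point by [s_south]. *)
Lemma s_fibre z z' : 0 <= z.2 <= pi / 2 -> 0 <= z'.2 <= pi / 2 ->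
  f (s z) = f (s z') -> s z = s z'.
Proof.
move=> hz hz'; rewrite !f_s => e.
have pi0 := pi_gt0 R.
have phr w : 0 <= w.2 <= pi / 2 -> 0 <= ph w <= pi.
  move=> /andP[w0 w1]; have s0 : 0 <= sin w.2 by apply: sin_ge0_pi; apply/andP; split; lra.
  apply/andP; split; first by rewrite mulr_ge0 // ltW.
  by rewrite ler_piMr ?sin_le1 // ltW.
have [a0 a1 a2] := vec3E (ca z * sin (ph z)) (sa z * sin (ph z)) (cos (ph z)).
have [b0 b1 b2] := vec3E (ca z' * sin (ph z')) (sa z' * sin (ph z')) (cos (ph z')).
have ephi : ph z = ph z'.
  by apply: cos_inj; rewrite ?in_itv /= ?phr // -a2 -b2 -/(meridian _ _ _) e.
have [p00|pn0] := eqVneq (ph z) 0.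
  by rewrite /s -ephi p00 !lift0.
have [sp0|sp0] := eqVneq (sin (ph z)) 0; last first.
  have ec : ca z = ca z'.
    by apply: (mulIf sp0); rewrite -a0 [in RHS]ephi -b0 -!/(meridian _ _ _) e.
  have es : sa z = sa z'.
    by apply: (mulIf sp0); rewrite -a1 [in RHS]ephi -b1 -!/(meridian _ _ _) e.
  by rewrite /s ec es ephi.
(* the remaining colatitude is pi, that is z.2 = pi / 2 *)
have phpi : ph z = pi.
  apply/eqP; rewrite eq_le; have /andP[p0' p1] := phr z hz; rewrite p1 /= leNgt.
  apply/negP => lt; have : 0 < sin (ph z).
    by apply: sin_gt0_pi; rewrite lt lt_neqAle eq_sym pn0 p0'.
  by rewrite sp0 ltxx.
have top w : 0 <= w.2 <= pi / 2 -> ph w = pi -> w = (w.1, pi / 2).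
  case: w => w1 w2 /= /andP[w0 w3] pw; congr pair.
  have s1 : sin w2 = sin (pi / 2).
    rewrite sin_pihalf; apply: (mulfI (lt0r_neq0 pi0)).
    by rewrite mulr1; exact: pw.
  have i1 : w2 \in `[- (pi / 2), pi / 2]%R by rewrite in_itv /=; apply/andP; split; lra.
  have i2 : pi / 2 \in `[- (pi / 2), pi / 2 : R]%R by rewrite in_itv /=; apply/andP; split; lra.
  by rewrite -(sinK i1) s1 sinK.
rewrite (top z) // (top z') // -?ephi //; exact: s_south.
Qed.

Lemma covering_of_lift : injective f /\ forall y, sphere y -> exists p, f p = y.
Proof.
have pi0 := pi_gt0 R.
pose Q : set (R * R) := `[- pi, pi] `*` `[0, pi / 2].
have cQ : compact Q by apply: compact_setX; exact: segment_compact.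
have Qne : Q !=set0.
  by exists (0, 0); split; rewrite /= in_itv /=; apply/andP; split; lra.
have onto y : sphere y -> exists2 z, Q z & f (s z) = y.
  move=> /meridian_surjective [t [phi [ht /andP[p0' p1] <-]]].
  have pp : 0 <= phi / pi <= 1.
    apply/andP; split; first by rewrite divr_ge0 // ltW.
    by rewrite ler_pdivrMr // mul1r.
  have ppi : phi / pi \in `[-1, 1]%R by rewrite in_itv /=; apply/andP; split; lra.
  have pp1 : -1 <= phi / pi <= 1 by apply/andP; split; lra.
  exists (t, asin (phi / pi)); last first.
    by rewrite f_s /ca /sa /ph /= asinK // mulrC divfK // gt_eqF.
  split; rewrite /= in_itv //=.
  rewrite asin_lepi2 // andbT leNgt; apply/negP => lt.
  have h1 := asin_geNpi2 pp1.
  have : 0 < sin (- asin (phi / pi)).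
    by apply: sin_gt0_pi; apply/andP; split; lra.
  by rewrite sinN asinK //; lra.
have fib z z' : Q z -> Q z' -> f (s z) = f (s z') -> s z = s z'.
  by move=> [_ /= z2] [_ /= z2']; apply: s_fibre; [move: z2|move: z2']; rewrite in_itv.
have [im inj] := compact_section T_hausdorff T_connected f_continuous f_loc_inj Qne cQ
  s_continuous fib (fun p => onto (f p) (f_sphere p)).
by split=> // y /onto [z _ <-]; exists (s z).
Qed.

End Lift.

(** The sphere is simply connected: a local homeomorphism from a compact
    connected space is a homeomorphism.  The simple connectedness enters through
    the family of meridians, which sweep out the sphere from one pole to the
    other. *)
Lemma sphere_covering : injective f /\ forall y, sphere y -> exists p, f p = y.
Proof.
have [E hE] := sheet_relation_exists T_hausdorff T_compact f_loc_inj.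
have [eps eps0 Heps] := sheet_radius T_compact f_continuous f_loc_open hE.
apply: (@covering_of_lift E hE eps Heps (Num.bound (pi / eps))).
have : pi / eps < (Num.bound (pi / eps))%:R.
  by apply: archi_boundP; rewrite divr_ge0 ?pi_ge0 // ltW.
rewrite ltr_pdivrMr // mulrC => h; apply: lt_le_trans h _.
by rewrite ler_pM2l // ler_nat.
Qed.

End SphereCovering.

(** * Horizontal surfaces *)

Lemma pderive_cst (R : realType) (V : normedModType R) i (P : V) (u : 'rV[R]_2) :
  pderive i (cst P) u = 0.
Proof. exact: derive_cst. Qed.

Local Opaque pderive.

Lemma ball_segment (R : realType) (u0 v w : 'rV[R]_2) (d t : R) :
  ball u0 d v -> ball u0 d w -> 0 <= t <= 1 -> ball u0 d (v + t *: (w - v)).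
Proof.
rewrite -!ball_normE /= => bv bw /andP[t0 t1].
have -> : u0 - (v + t *: (w - v)) = (1 - t) *: (u0 - v) + t *: (u0 - w).
  by apply/rowP => i; rewrite !mxE; ring.
apply: le_lt_trans (ler_normD _ _) _; rewrite !normrZ (ger0_norm t0) ger0_norm ?subr_ge0 //.
have [->|tn0] := eqVneq t 0; first by rewrite subr0 mul1r mul0r addr0.
have tp : 0 < t by rewrite lt_neqAle eq_sym tn0.
have h1 : (1 - t) * `|u0 - v| <= (1 - t) * d by rewrite ler_wpM2l ?subr_ge0 // ltW.
have h2 : t * `|u0 - w| < t * d by rewrite ltr_pM2l.
by move: h1 h2; move: `|u0 - v| `|u0 - w| => *; lra.
Qed.

Lemma quadratic_form_definite (R : realFieldType) (p q r s b c : R) :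
  0 < p -> 0 < 4 * (p * s) - (q + r) ^+ 2 ->
  b * (b * p + c * q) + c * (b * r + c * s) = 0 -> b = 0 /\ c = 0.
Proof.
move=> p0 d0 e0.
have e : (2 * p * b + (q + r) * c) ^+ 2 + (4 * (p * s) - (q + r) ^+ 2) * c ^+ 2 = 0.
  by rewrite -[RHS](mulr0 (4 * p)) -e0; ring.
have s0 := sqr_ge0 (2 * p * b + (q + r) * c).
have s1 : 0 <= (4 * (p * s) - (q + r) ^+ 2) * c ^+ 2 by rewrite mulr_ge0 ?sqr_ge0 // ltW.
have c0 : c = 0.
  have /eqP : (4 * (p * s) - (q + r) ^+ 2) * c ^+ 2 = 0 by lra.
  by rewrite mulf_eq0 gt_eqF //= sqrf_eq0 => /eqP.
split=> //; move: e0; rewrite c0 !mul0r !addr0 => /eqP.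
by rewrite mulrA mulf_eq0 (gt_eqF p0) orbF mulf_eq0 orbb => /eqP.
Qed.

Section UnitVectors.
Variable R : realType.
Local Notation form := (form3 (1 : R)).
Implicit Types a b y : 'rV[R]_3.

Lemma unit_form_bounds a b : form a a = 1 -> form b b = 1 ->
  -1 <= form a b <= 1 /\ (form a b = 1 -> a = b).
Proof.
rewrite /form3 !mul1r; set a0 := a 0 _; set a1 := a 0 _; set a2 := a 0 _.
set b0 := b 0 _; set b1 := b 0 _; set b2 := b 0 _ => aa bb.
have s0 := sqr_ge0 (a0 - b0); have s1 := sqr_ge0 (a1 - b1); have s2 := sqr_ge0 (a2 - b2).
have r0 := sqr_ge0 (a0 + b0); have r1 := sqr_ge0 (a1 + b1); have r2 := sqr_ge0 (a2 + b2).
have dif : (a0 - b0) ^+ 2 + (a1 - b1) ^+ 2 + (a2 - b2) ^+ 2 =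
  2 - 2 * (a0 * b0 + a1 * b1 + a2 * b2).
  by move: aa bb; rewrite !expr2; lra.
split.
  by apply/andP; split; move: s0 s1 s2 r0 r1 r2; rewrite !expr2; lra.
move=> ab; rewrite ab in dif.
have z0 : (a0 - b0) ^+ 2 = 0 by lra.
have z1 : (a1 - b1) ^+ 2 = 0 by lra.
have z2 : (a2 - b2) ^+ 2 = 0 by lra.
by apply: rV3_eq; apply/eqP; rewrite -subr_eq0 -sqrf_eq0; apply/eqP.
Qed.

Lemma unit_form_pert a y z (r : R) : form a a = 1 -> ball y r z ->
  `|form a z - form a y| <= 3 * r.
Proof.
rewrite /form3 !mul1r; set a0 := a 0 _; set a1 := a 0 _; set a2 := a 0 _ => aa [_ yz].
have le1 k : k ^+ 2 <= 1 -> `|k| <= 1 :> R.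
  by move=> k1; rewrite -(@ler_pXn2r _ 2) ?nnegrE // expr1n real_normK ?num_real.
have s0 := sqr_ge0 a0; have s1 := sqr_ge0 a1; have s2 := sqr_ge0 a2.
have h0 : `|a0| <= 1 by apply: le1; move: s0 s1 s2; rewrite !expr2; lra.
have h1 : `|a1| <= 1 by apply: le1; move: s0 s1 s2; rewrite !expr2; lra.
have h2 : `|a2| <= 1 by apply: le1; move: s0 s1 s2; rewrite !expr2; lra.
have entry (k : 'I_3) (c : R) : `|c| <= 1 -> `|c * (z 0 k - y 0 k)| <= r.
  move=> c1; rewrite normrM; have := yz 0 k; rewrite /ball /= distrC => /ltW.
  by apply: le_trans; rewrite ler_piMl.
rewrite (_ : _ - _ = a0 * (z 0 (inord 0) - y 0 (inord 0)) + a1 * (z 0 (inord 1) - y 0 (inord 1))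
   + a2 * (z 0 (inord 2) - y 0 (inord 2))); last by ring.
have e0 := entry (inord 0) a0 h0; have e1 := entry (inord 1) a1 h1.
have e2 := entry (inord 2) a2 h2.
apply: le_trans (ler_normD _ _) _; apply: le_trans (lerD (ler_normD _ _) (lexx _)) _.
by move: e0 e1 e2; move: `|_| `|_| `|_| => *; lra.
Qed.

End UnitVectors.

Lemma small_gap (R : realFieldType) (g : R) : g <= 2 -> 0 < 1 - 3 * (g / 8).
Proof. by move=> g2; lra. Qed.

Section Horizontal.
Variables (R : realType) (kappa : R) (T : topologicalType).
Variables (A : set (local_param R T)) (H : R -> R) (psi eta : T -> 'rV[R]_3 * R).
Hypothesis hkappa : kappa = -1 \/ kappa = 1.
Hypothesis hsurf : H_surface kappa A H psi eta.
Variable t0 : R.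
Hypothesis height_t0 : forall p, (psi p).2 = t0.
Local Notation met := (metric kappa).
Local Notation form := (form3 kappa).

Section OneChart.
Variable x : local_param R T.
Hypothesis Ax : A x.
Let X := psi \o x.
Let U := lp_dom x.
Let C2 := chart_C2 hsurf Ax.
Let fr u (Uu : U u) := chart_frame hsurf Ax Uu.

Lemma horizontal_derivative u i : U u -> (pderive i X u).2 = 0.
Proof.
move=> Uu; have [D _] := (C2_functional C2 (functional_height R)).1 u Uu i.
have e : 'D_(delta_mx 0 i) ((fun P : 'rV[R]_3 * R => P.2) \o X) u = (pderive i X u).2.
  by case: D.
have c : (fun P : 'rV[R]_3 * R => P.2) \o X = cst t0.
  by apply/funext => v /=; exact: height_t0.
by rewrite -e c derive_cst.
Qed.

(** The coordinate tangent vectors are then two independent vectors of a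
    horizontal plane of the three-space, both orthogonal to the position. *)
Lemma critical_axis u : U u ->
  (\forall v \near u, (psi (x v)).1 0 (inord 2) <= (psi (x u)).1 0 (inord 2)) ->
  (psi (x u)).1 0 (inord 0) = 0 /\ (psi (x u)).1 0 (inord 1) = 0.
Proof.
move=> Uu hmax.
have fc := functional_coordinate R (inord 2).
have [pf pf1] := C2_functional C2 fc.
have d0 : (0 : R) < 1 * 1 - 0 ^+ 2 by rewrite expr0n mul1r subr0.
have [e0 e1 _] := interior_max (lp_open_dom (l := x)) Uu pf pf1 ltr01 d0 hmax.
have z0 : (pderive 0 X u).1 0 (inord 2) = 0 := e0.
have z1 : (pderive 1 X u).1 0 (inord 2) = 0 := e1.
move=> {e0 e1}.
have [[_ qX0 qX1 _] _ free] := fr Uu.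
have h0 := horizontal_derivative 0 Uu; have h1 := horizontal_derivative 1 Uu.
move: (pderive 0 X u) (pderive 1 X u) qX0 qX1 free h0 h1 z0 z1 => [X0 s0] [X1 s1] /=.
rewrite /form3 => qX0 qX1 free h0 h1 z0 z1; move: qX0 qX1.
rewrite z0 z1 h0 h1 in free *.
set q0 := _ 0 (inord 0); set q1 := _ 0 (inord 1).
set a0 := X0 0 (inord 0); set b0 := X0 0 (inord 1).
set a1 := X1 0 (inord 0); set b1 := X1 0 (inord 1).
rewrite !mulr0 !addr0 => qX0 qX1.
have comb (r t : R) : r * a0 + t * a1 = 0 -> r * b0 + t * b1 = 0 -> r = 0 /\ t = 0.
  move=> ea eb; apply: free; congr pair.
    by apply: rV3_eq0; rewrite !mxE // z0 z1 !mulr0 addr0.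
  by rewrite /= -[r *: 0]/(r * 0) -[t *: 0]/(t * 0) !mulr0 addr0.
have [d|d] := eqVneq (a0 * b1 - a1 * b0) 0; last first.
  split; apply: (mulIf d); rewrite mul0r.
    by rewrite (_ : q0 * _ = (q0 * a0 + q1 * b0) * b1 - (q0 * a1 + q1 * b1) * b0);
      [rewrite qX0 qX1; ring|ring].
  by rewrite (_ : q1 * _ = (q0 * a1 + q1 * b1) * a0 - (q0 * a0 + q1 * b0) * a1);
      [rewrite qX0 qX1; ring|ring].
have [ea1 ea0] := comb a1 (- a0) ltac:(ring) ltac:(lra).
have [eb1 eb0] := comb b1 (- b0) ltac:(lra) ltac:(ring).
have [|| e _] := comb 1 0.
- by move/eqP: ea0; rewrite oppr_eq0 => /eqP ->; rewrite ea1; ring.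
- by move/eqP: eb0; rewrite oppr_eq0 => /eqP ->; rewrite eb1; ring.
by move/eqP: e; rewrite oner_eq0.
Qed.

(** If two points at [v] and [w] had the same image, the mean value theorem for
    the product with the vector that the differential at [u0] assigns to
    [w - v] would give a zero of a quadratic form close to the first fundamental
    form, hence definite. *)
Lemma chart_locally_injective u0 : U u0 -> exists2 d : R, 0 < d &
  ball u0 d `<=` U /\ forall v w, ball u0 d v -> ball u0 d w -> X v = X w -> v = w.
Proof.
move=> Uu0; have [cX C1] := C2.
have [E0 D0] := first_form_posdef hkappa (fr Uu0).
pose g i j v := met (pderive i X v) (pderive j X u0).
have cg i j : {for u0, continuous (g i j)}.
  apply: metric_continuous; last exact: cst_continuous.
  by have [_ [cXi _]] := C1 i; exact: cXi.
pose disc v := 4 * (g 0 0 v * g 1 1 v) - (g 0 1 v + g 1 0 v) ^+ 2.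
have cdisc : {for u0, continuous disc}.
  have c4 : {for u0, continuous (fun v => 4 * (g 0 0 v * g 1 1 v))}.
    by apply: continuousM; [exact: cst_continuous|exact: continuousM].
  have cs := continuousD (cg 0 1) (cg 1 0).
  exact: (continuousB c4 (continuousM cs cs)).
have n1 : \forall v \near u0, 0 < g 0 0 v.
  by have /cvgr_gt := cg 0 0; apply.
have n2 : \forall v \near u0, 0 < disc v.
  have dE : disc u0 = 4 * (g 0 0 u0 * g 1 1 u0 - g 0 1 u0 ^+ 2).
    rewrite /disc; have -> : g 1 0 u0 = g 0 1 u0 by exact: metricC.
    by move: (g 0 0 u0) (g 1 1 u0) (g 0 1 u0) => *; ring.
  by have /cvgr_gt := cdisc; apply; rewrite dE pmulr_rgt0.
have nU := chart_open_nbhs Uu0.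
have nb := @filterI _ (nbhs u0) (nbhs_filter u0) _ _ nU
  (@filterI _ (nbhs u0) (nbhs_filter u0) _ _ n1 n2).
case/nbhs_ballP: nb => d /= d0 Hd; exists d => //; split; first by move=> v /Hd [].
move=> v w bv bw XE; apply/eqP; rewrite eq_sym -subr_eq0; apply/eqP.
pose a := w - v.
pose V := a 0 0 *: pderive 0 X u0 + a 0 1 *: pderive 1 X u0.
pose G z := a 0 0 * met (pderive 0 X z) V + a 0 1 * met (pderive 1 X z) V.
have [pf _] := C2_functional C2 (functional_metric kappa V).
have seg (t : R) : 0 <= t <= 1 -> ball u0 d (v + t *: a).
  exact: ball_segment.
have DL (t : R) : 0 <= t <= 1 ->
    is_derive (v + t *: a) a ((fun P => met P V) \o X) (G (v + t *: a)).
  move=> ht; have [Ut _] := Hd _ (seg t ht).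
  exact: (directional_derivative a (lp_open_dom (l := x)) pf Ut).
have [t ht] := mean_value_line DL.
have va : v + a = w by rewrite /a addrC subrK.
rewrite /= va XE subrr => /esym G0.
have [_ [g00 gd]] := Hd _ (seg t ht).
move: G0 g00 gd; set z := v + _ => G0 g00 gd.
have Ge : a 0 0 * (a 0 0 * g 0 0 z + a 0 1 * g 0 1 z) +
    a 0 1 * (a 0 0 * g 1 0 z + a 0 1 * g 1 1 z) = 0.
  have c Z : met Z V = a 0 0 * met Z (pderive 0 X u0) + a 0 1 * met Z (pderive 1 X u0).
    exact: metric_comb.
  transitivity (G z); last exact: G0.
  exact: (congr2 +%R (congr1 ( *%R (a 0 0)) (esym (c (pderive 0 X z))))
    (congr1 ( *%R (a 0 1)) (esym (c (pderive 1 X z))))).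
have [a0 a1] := quadratic_form_definite g00 gd Ge.
by rewrite [w - v]plane_decomp -/a a0 a1 !scale0r addr0.
Qed.

(** For [y] in the sphere near the position at [u0], the product with [y] attains
    its maximum over a small disc at an interior point, because on the boundary
    the immersion stays away from its value at the centre.  There [y] is
    orthogonal to the surface, so it is the position itself. *)
Lemma chart_locally_open u0 (W : set 'rV[R]_2) : kappa = 1 -> U u0 -> nbhs u0 W ->
  exists2 r : R, 0 < r & forall y, sphere y -> ball (X u0).1 r y ->
    exists2 v, U v /\ W v & (X v).1 = y.
Proof.
move=> k1 Uu0 Ww.
have [d d0 [dU inj]] := chart_locally_injective Uu0.
case/nbhs_ballP: Ww => e /= e0 eW.
pose m := Num.min d e; have m0 : 0 < m by rewrite lt_min d0.
have md : m <= d by rewrite ge_min lexx.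
have me : m <= e by rewrite ge_min lexx orbT.
have mU v : sq (v - u0) < m ^+ 2 -> [/\ U v, W v & ball u0 d v].
  move=> vm; have bd : ball u0 d v by apply: (le_ball md); exact: sq_lt_ball.
  split=> //; first exact: dU.
  by apply: eW; apply: (le_ball me); exact: sq_lt_ball.
pose s := m ^+ 2 / 2.
have s0 : 0 < s by rewrite divr_gt0 // exprn_gt0.
have sm : s < m ^+ 2 by rewrite /s ltr_pdivrMr // ltr_pMr ?ltr1n // exprn_gt0.
pose D := [set v : 'rV[R]_2 | sq (v - u0) <= s].
have cD : compact D by exact: disc_compact.
have DU v : D v -> [/\ U v, W v & ball u0 d v].
  by move=> Dv; apply: mU; apply: le_lt_trans sm.
have cf (y : 'rV[R]_3) (B : set 'rV[R]_2) : B `<=` D ->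
    {within B, continuous (fun v => form (X v).1 y)}.
  move=> BD; apply: continuous_in_subspaceT => v; rewrite inE => /BD /DU [Uv _ _].
  have cX : {for v, continuous X} by have [cX _] := C2; exact: cX.
  have cm := @metric_continuous R kappa _ X (cst (y, 0)) v cX (@cst_continuous _ _ _ _).
  have E : (fun v => form (X v).1 y) = (fun v => met (X v) (cst (y, 0) v)).
    by apply/funext => w; rewrite /metric /= mulr0 addr0.
  by rewrite E; exact: cm.
have unit v : form (X v).1 (X v).1 = 1 by rewrite -[RHS]k1; exact: (chart_position hsurf).
(* a uniform gap on the boundary of the disc *)
pose S := D `&` [set v : 'rV[R]_2 | s <= sq (v - u0)].
have [g g0 gap] : exists2 g : R, 0 < g &
    g <= 2 /\ forall v, S v -> form (X v).1 (X u0).1 <= 1 - g.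
  have [Sn0|S0] := pselect (S !=set0); last first.
    by exists 1 => //; split; [rewrite ler1n|move=> v Sv; case: S0; exists v].
  have cS : compact S.
    apply: compact_closedI => //.
    have -> : [set v : 'rV[R]_2 | s <= sq (v - u0)] = (fun v => sq (v - u0)) @^-1` [set t | s <= t] by [].
    by apply: closed_comp; [move=> v _; exact: sq_continuous|exact: closed_ge].
  have SD : S `<=` D by move=> v [].
  have [c cS' cmax] := compact_EVT_max Sn0 cS (cf (X u0).1 S SD).
  rewrite inE in cS'; have [Dc /= sc] := cS'.
  have uc := unit c; have u0' := unit u0; rewrite k1 in uc u0' *.
  have [/andP[lo hi] eq1] := unit_form_bounds uc u0'.
  exists (1 - form3 1 (X c).1 (X u0).1).
    rewrite subr_gt0 lt_neqAle hi andbT; apply/eqP => /eq1 e1.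
    have XE : X c = X u0.
      by move: e1 (height_t0 (x c)) (height_t0 (x u0)); rewrite /X /=;
        case: (psi (x c)) (psi (x u0)) => [? ?] [? ?] /= -> -> ->.
    have [_ _ bc] := DU c Dc.
    have cu : c = u0 by apply: inj => //; exact: ballxx.
    by move: sc; rewrite cu subrr /sq /dot !mxE mulr0 addr0 leNgt s0.
  split; first by lra.
  by move=> v Sv; have := cmax v; rewrite inE k1 => /(_ Sv); lra.
pose r := g / 8; have r0 : 0 < r by rewrite divr_gt0.
exists r => // y yS yr.
have pert v : `|form (X v).1 y - form (X v).1 (X u0).1| <= 3 * r.
  by have uv := unit v; rewrite k1 in uv *; exact: unit_form_pert.
have Du0 : D u0 by rewrite /D /= subrr /sq /dot !mxE mulr0 addr0 ltW.
have [z zD zmax] := compact_EVT_max (ex_intro _ u0 Du0) cD (cf y D (@subset_refl _ D)).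
rewrite inE in zD.
have zu : form (X u0).1 y <= form (X z).1 y by apply: zmax; rewrite inE.
have [Uz Wz _] := DU z zD.
have p0 := pert u0; have pz := pert z; rewrite unit in p0.
have low : 1 - 3 * r <= form (X u0).1 y by move: p0; rewrite ler_norml => /andP[p0 _]; lra.
have zy : sq (z - u0) < s.
  rewrite ltNge; apply/negP => sz; have := gap.2 z (conj zD sz).
  move: pz; rewrite ler_norml => /andP[_ pz]; rewrite /r in low pz.
  by move: zu low pz; move: (form _ _) (form _ _) (form _ _) => *; lra.
have nz : \forall v \near z, met (X v) (y, 0) <= met (X z) (y, 0).
  have : \forall v \near z, sq (v - u0) < s.
    by have /cvgr_lt := @sq_continuous R u0 z; apply.
  apply: filterS => v vs; rewrite /metric /= !mulr0 !addr0.
  by apply: zmax; rewrite inE /D /=; exact: ltW.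
have [pf pf1] := C2_functional C2 (functional_metric kappa (y, 0)).
have d1 : (0 : R) < 1 * 1 - 0 ^+ 2 by rewrite expr0n mul1r subr0.
have [e0' e1' _] := interior_max (lp_open_dom (l := x)) Uz pf pf1 ltr01 d1 nz.
have y0 : met (y, 0) (pderive 0 X z) = 0 by rewrite metricC; exact: e0'.
have y1 : met (y, 0) (pderive 1 X z) = 0 by rewrite metricC; exact: e1'.
pose q := (X z).1; pose lam := form q y.
have yE : y = lam *: q.
  have := normal_line hkappa (fr Uz) (horizontal_derivative 0 Uz)
    (horizontal_derivative 1 Uz) y0 y1.
  by rewrite {1}k1 mul1r.
have lam2 : lam ^+ 2 = 1.
  move: yS; rewrite /sphere /= -k1 yE => <-.
  have -> : form (lam *: q) (lam *: q) = lam ^+ 2 * form q q.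
    by rewrite /form3 !mxE; ring.
  by rewrite unit mulr1.
have lam_pos : 0 < lam := lt_le_trans (small_gap gap.1) (le_trans low zu).
have lam1 : lam = 1.
  by apply/eqP; rewrite -(@sqrp_eq1 _ lam) ?ltW // lam2.
by exists z => //; rewrite yE lam1 scale1r.
Qed.

End OneChart.
Hypothesis hclosed : closed_connected_surface A.
Let third p := (psi p).1 0 (inord 2).

Lemma psi_not_constant P : ~ (forall p, psi p = P).
Proof.
move=> cst_psi; have [[p _] _ _ _ _] := hclosed.
have [x Ax [u Uu _]] := chart_cover hclosed p.
have [_ _ free] := chart_frame hsurf Ax Uu.
have cX : psi \o x = cst P by apply/funext => v; exact: cst_psi.
have d0 i : pderive i (psi \o x) u = 0 by rewrite cX pderive_cst.
have [] := free 1 0; first by rewrite !d0 scaler0 scale0r addr0.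
by move=> e; move/eqP: e; rewrite oner_eq0.
Qed.

Lemma axis_point : exists p, [/\ forall q, third q <= third p,
  (psi p).1 0 (inord 0) = 0 & (psi p).1 0 (inord 1) = 0].
Proof.
have ct : continuous third.
  move=> p; apply: (@continuous_comp _ _ _ psi (fun P : 'rV[R]_3 * R => P.1 0 (inord 2))).
    exact: (psi_continuous hsurf hclosed).
  exact: coordinate_continuous.
have [p pmax] := function_max hclosed ct; exists p.
have [x Ax [u Uu xu]] := chart_cover hclosed p.
have umax : \forall v \near u, (psi (x v)).1 0 (inord 2) <= (psi (x u)).1 0 (inord 2).
  by apply: (@filterE _ _ (nbhs_filter u)) => v; rewrite xu; exact: pmax.
by have [e0 e1] := critical_axis Ax Uu umax; rewrite xu in e0 e1; split.
Qed.

Lemma position_form p : (psi p).1 0 (inord 0) ^+ 2 + (psi p).1 0 (inord 1) ^+ 2 +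
  kappa * third p ^+ 2 = kappa.
Proof. by have [[/(_ p) [e _] _] _ _] := hsurf; rewrite -[RHS]e /form3 /third; ring. Qed.

Lemma position_eq p c : (psi p).1 0 (inord 0) = 0 -> (psi p).1 0 (inord 1) = 0 ->
  third p = c -> psi p = (vec3 0 0 c, t0).
Proof.
move=> e0 e1 e2; rewrite [psi p]surjective_pairing height_t0; congr pair.
by have [v0 v1 v2] := vec3E (0 : R) 0 c; apply: rV3_eq; rewrite ?v0 ?v1 ?v2.
Qed.

(** On the hyperboloid the third coordinate is at least [1]; its maximum over a
    closed horizontal surface would be attained on the axis, where it equals
    [1], so the surface would be reduced to a point. *)
Lemma not_hyperbolic : kappa <> -1.
Proof.
move=> k1; have [p [pmax p0 p1]] := axis_point.
have pos q : 0 < third q.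
  by have [[/(_ q) [_ +] _] _ _] := hsurf; rewrite k1; apply; lra.
have tp : third p = 1.
  have := position_form p; rewrite p0 p1 k1 expr0n !add0r !mulN1r => /oppr_inj e.
  by apply/eqP; rewrite -(@sqrp_eq1 _ (third p)) ?ltW //; exact/eqP.
apply: (@psi_not_constant (vec3 0 0 1, t0)) => q.
have := position_form q; rewrite k1 => e.
have q1 : third q <= 1 by rewrite -tp; exact: pmax.
have s0 := sqr_ge0 ((psi q).1 0 (inord 0)); have s1 := sqr_ge0 ((psi q).1 0 (inord 1)).
have tq : third q ^+ 2 <= 1 by rewrite expr_le1 // ltW.
apply: position_eq.
- by apply/eqP; rewrite -sqrf_eq0; apply/eqP; lra.
- by apply/eqP; rewrite -sqrf_eq0; apply/eqP; lra.
have t2 : third q ^+ 2 = 1 by lra.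
by apply/eqP; rewrite -(@sqrp_eq1 _ (third q)) ?ltW //; exact/eqP.
Qed.

(** The third coordinate is maximal on the axis.  At the south pole its maximum
    would be [-1], and the surface would be reduced to that point. *)
Lemma north_pole : kappa = 1 -> exists p, (psi p).1 = vec3 0 0 1.
Proof.
move=> k1; have [p [pmax p0 p1]] := axis_point; exists p.
have := position_form p; rewrite p0 p1 k1 expr0n !add0r !mul1r => e.
have : (third p - 1) * (third p + 1) = 0 by rewrite -subr_sqr e expr1n subrr.
move/eqP; rewrite mulf_eq0 subr_eq0 addr_eq0 => /orP[/eqP tp|/eqP tp].
  by rewrite (position_eq p0 p1 tp).
exfalso; apply: (@psi_not_constant (vec3 0 0 (-1), t0)) => q.
have := position_form q; rewrite k1 mul1r => eq.
have q1 : third q <= -1 by rewrite -tp; exact: pmax.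
have s0 := sqr_ge0 ((psi q).1 0 (inord 0)); have s1 := sqr_ge0 ((psi q).1 0 (inord 1)).
have tq : 1 <= third q ^+ 2 by rewrite expr2; nra.
apply: position_eq.
- by apply/eqP; rewrite -sqrf_eq0; apply/eqP; lra.
- by apply/eqP; rewrite -sqrf_eq0; apply/eqP; lra.
have t2 : (third q - 1) * (third q + 1) = 0 by rewrite -subr_sqr expr1n; lra.
by move/eqP: t2; rewrite mulf_eq0 => /orP[/eqP h|/eqP h]; lra.
Qed.

Lemma horizontal_slice : kappa = 1 -> injective psi /\ range psi = slice kappa t0.
Proof.
move=> k1; pose f p := (psi p).1.
have [p0 fp0] := north_pole k1.
have [_ hT cT conT _] := hclosed.
have cpsi := psi_continuous hsurf hclosed.
have cf : continuous f.
  by move=> p; apply: (@continuous_comp _ _ _ psi fst); [exact: cpsi|exact: cvg_fst].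
have psiE p : psi p = (f p, t0) by rewrite [psi p]surjective_pairing height_t0.
have f_sphere p : sphere (f p).
  by have [[/(_ p) [e _] _] _ _] := hsurf; move: e; rewrite k1.
have f_inj : locally_injective f.
  move=> p; have [x Ax [u Uu xu]] := chart_cover hclosed p.
  have [d d0 [dU inj]] := chart_locally_injective Ax Uu.
  exists [set q | exists2 v, ball u d v & x v = q].
    rewrite -xu; apply/(near_chart (fun q => exists2 v, ball u d v & x v = q) Uu).
    have : \forall v \near u, ball u d v by exact: nbhsx_ballx.
    by apply: filterS => v bv; exists v.
  move=> q q' [v bv <-] [w bw <-] e; congr (x _); apply: inj => //.
  by rewrite /= !psiE e.
have f_open : locally_open_onto (@sphere R) f.
  move=> p W Wp; have [x Ax [u Uu xu]] := chart_cover hclosed p.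
  have Wu : nbhs u (x @^-1` W) by rewrite -xu in Wp; exact: lp_map_continuous Uu _ Wp.
  have [r r0 Hr] := chart_locally_open Ax k1 Uu Wu.
  exists r => // y yS yr; have [|v [_ Wv] fv] := Hr y yS; first by rewrite /= xu.
  by exists (x v).
have [inj onto] := sphere_covering hT cT conT cf f_sphere f_inj f_open fp0.
split; first by move=> p q e; apply: inj; rewrite /f e.
apply/seteqP; split=> [_ [p _ <-]|[y t] [/= [yS _] ->]].
  by split=> /=; [have [[/(_ p)] ] := hsurf|].
by have [|p fp] := onto y; [rewrite /sphere /= -k1|exists p => //; rewrite psiE fp].
Qed.

End Horizontal.



(** * Closed H-surfaces *)

Theorem proposition3p5 (R : realType) (kappa : R) (H : R -> R)
    (T : topologicalType) (A : set (local_param R T))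
    (psi eta : T -> 'rV[R]_3 * R)
    (hkappa : kappa = -1 \/ kappa = 1)
    (hH : C1_on_segment H)
    (hzeros : zeros_isolated_of_finite_multiplicity H)
    (hclosed : closed_connected_surface A)
    (hsurf : H_surface kappa A H psi eta) :
  (kappa = -1 -> 0 < H (-1) * H 1) /\
  (kappa = 1 ->
     0 < H (-1) * H 1 \/
     (H (-1) * H 1 = 0 /\
      exists t0 : R, injective psi /\ range psi = slice kappa t0)).
Proof.
have [pos|[HH [t0 flat]]] := horizontal_or_positive hkappa hsurf hclosed hH.
  by split=> // _; left.
split=> k1.
  by exfalso; exact: (not_hyperbolic hsurf flat hclosed k1).
by right; split=> //; exists t0; exact: (horizontal_slice hkappa hsurf flat hclosed k1).
Qed.
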